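(* Let $(X,\tau)$ be a Polish space and let $G$ be a bipartite Borel graph on $X$ (i.e. $G$ has no odd cycles). Then $\chi'_{BM}(G)\leq \Delta(G)+1$.
   Context: A Borel graph on a Polish space $X$ is a graph with vertex set $X$ whose edge set is a Borel subset of $X^2$ (symmetric and irreflexive). $\Delta(G)$ denotes the maximum degree of $G$ (the supremum of vertex degrees, possibly an infinite cardinal). A (proper) edge coloring assigns colors to edges so that edges sharing a vertex receive different colors. The Borel edge chromatic number $\chi'_B(G)$ is the least cardinal $\kappa$ such that $G$ admits a Borel proper edge coloring with $\kappa$ colors. A set $C\subseteq X$ is $G$-invariant if it is a union of connected components of $G$. The Baire measurable edge chromatic number $\chi'_{BM}(G)$ is the minimum of $\chi'_B(G\upharpoonright C)$ over all $\tau$-comeagre $G$-invariant Borel sets $C\subseteq X$, where $G\upharpoonright C$ is the induced subgraph on $C$. *)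

(* Defs.v *)
From mathcomp Require Import all_boot all_order all_algebra.
From mathcomp Require Import mathcomp_extra boolp classical_sets functions.
From mathcomp Require Import cardinality reals topology measure.

Set Implicit Arguments.
Unset Strict Implicit.
Unset Printing Implicit Defensive.

Import Order.TTheory GRing.Theory Num.Theory.

Local Open Scope classical_set_scope.
Local Open Scope card_scope.
Local Open Scope ring_scope.

(* The real field R only serves as the codomain of metrics. *)
Section polish.
Context {R : realType} {T : topologicalType}.

Definition is_metric (d : T -> T -> R) : Prop :=
  [/\ forall x y, (d x y = 0) <-> (x = y),
      forall x y, d x y = d y x &
      forall x y z, d x z <= d x y + d y z].

Definition metrizes (d : T -> T -> R) : Prop :=
  forall (x : T) (A : set T),
    nbhs x A <-> exists2 e, 0 < e & [set y | d x y < e] `<=` A.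

Definition cauchy_seq (d : T -> T -> R) (u : nat -> T) : Prop :=
  forall e, 0 < e -> exists N, forall m n,
    (N <= m)%N -> (N <= n)%N -> d (u m) (u n) < e.

Definition complete_metric (d : T -> T -> R) : Prop :=
  forall u : nat -> T, cauchy_seq d u -> exists l : T, u @ \oo --> l.

End polish.

Definition separable (T : topologicalType) : Prop :=
  exists2 D : set T, countable D & dense D.

(* [completeType] is not used since it excludes the empty space. *)
Definition polish (R : realType) (T : topologicalType) : Prop :=
  separable T /\
  exists d : T -> T -> R, [/\ is_metric d, metrizes d & complete_metric d].

Section borel_baire.
Context {T : topologicalType}.

Definition borel (A : set T) : Prop := <<s open >> A.

Definition nowhere_dense (A : set T) : Prop := (closure A)^° = set0.

Definition meagre (A : set T) : Prop :=
  exists2 F : nat -> set T,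
    (forall n, nowhere_dense (F n)) & A = \bigcup_n F n.

Definition comeagre (A : set T) : Prop := meagre (~` A).

End borel_baire.

(* Cardinal numbers are represented by sets, compared with [#<=] and [#=].
   Vertex degrees and the cardinals of color spaces are at most the cardinal of
   the continuum, so that subsets of [nat -> bool] represent all of them. *)
Definition cardinal := set (nat -> bool).

(* A cardinal of least size in P; the continuum if P is empty. *)
Definition least_card (P : set cardinal) : cardinal :=
  xget [set: nat -> bool] [set K | P K /\ forall L, P L -> K #<= L].

Lemma least_cardP (P : set cardinal) : P !=set0 ->
  P (least_card P) /\ forall L, P L -> least_card P #<= L.
Proof.
move=> [K0 PK0].
have [] // := @xgetPex _ [set: nat -> bool]
  [set K | P K /\ forall L, P L -> K #<= L].
pose U := nat -> bool.
pose good (S : set (cardinal -> U)) :=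
  (forall f K, S f -> P K -> K (f K)) /\
  (forall f g K, S f -> S g -> P K -> f K = g K -> f = g).
have [S [[Sin Sinj] Smax]] : exists S, good S /\ forall T, S `<` T -> ~ good T.
  apply: Zorn_bigcup => F Fgood Ftot; split.
    by move=> f K [S FS Sf] PK; have [Fin _] := Fgood _ FS; exact: (Fin f K Sf PK).
  move=> f g K [S FS Sf] [T FT Tg] PK fg.
  have [ST|TS] := Ftot _ _ FS FT.
    by have [_ inj] := Fgood _ FT; exact: (inj f g K (ST _ Sf) Tg PK fg).
  by have [_ inj] := Fgood _ FS; exact: (inj f g K Sf (TS _ Tg) PK fg).
have [K [PK Ksurj]] :
    exists K, P K /\ forall b, K b -> exists2 f, S f & f K = b.
  apply: contrapT => noK.
  have pick K : exists b, P K -> K b /\ forall f, S f -> f K <> b.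
    have [PK|] := pselect (P K); last by move=> ?; exists point.
    apply: contrapT => nob; apply: noK; exists K; split => // b Kb.
    apply: contrapT => nof; apply: nob; exists b => _; split => // f Sf fb.
    by apply: nof; exists f.
  have [h hP] := choice pick.
  apply: (Smax (S `|` [set h])).
    split; first by move=> f Sf; left.
    move=> /(_ h (or_intror erefl)) Sh.
    by have [_ /(_ _ Sh)] := hP _ PK0; apply.
  split=> [f K [Sf|->] PK|f g K [Sf|->] [Sg|->] PK //].
  - exact: (Sin f K Sf PK).
  - by have [] := hP _ PK.
  - exact: Sinj.
  - by move=> fh; have [_ /(_ _ Sf)] := hP _ PK.
  - by move=> /esym gh; have [_ /(_ _ Sg)] := hP _ PK.
exists K; split => // L PL.
have /choice[F FP] : forall b, exists f, K b -> S f /\ f K = b.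
  move=> b; have [Kb|] := pselect (K b); last by move=> ?; exists (fun=> point).
  by have [f Sf fb] := Ksurj _ Kb; exists f.
apply/pcard_leP/injfunPex; exists (fun b => F b L).
  by move=> b Kb; have [Sf _] := FP _ Kb; exact: (Sin (F b) L Sf PL).
move=> b c /set_mem Kb /set_mem Kc FL.
have [Sb Fb] := FP _ Kb; have [Sc Fc] := FP _ Kc.
by rewrite -Fb -Fc (Sinj _ _ _ Sb Sc PL FL).
Qed.

Lemma polish_card_le (R : realType) (T : topologicalType) :
  polish R T -> [set: T] #<= [set: nat -> bool].
Proof.
move=> [[D /countable_injP[i iinj] dD] [d [[d0 dC dD3] dN _]]].
pose r k : R := (k.+1%:R)^-1.
have dxx x : d x x = 0 by apply/d0.
apply/pcard_injP.
exists (fun x n => `[< exists q k, [/\ D q, n = pickle (i q, k) & d x q < r k] >]).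
move=> x y _ _ exy; apply/d0/eqP; rewrite eq_le; apply/andP.
have d_ge0 : 0 <= d x y.
  by have := dD3 x y x; rewrite dxx (dC y x) -mulr2n pmulrn_lge0.
split => //; rewrite leNgt; apply/negP => dxy.
have [k rk] : exists k, r k < d x y / 2.
  have e0 : 0 < d x y / 2 by rewrite divr_gt0.
  exists (Num.trunc ((d x y / 2)^-1)).
  rewrite /r -[ltRHS]invrK ltf_pV2 ?posrE ?invr_gt0 ?ltr0n //.
  by have /andP[] := truncn_itv (ltW (etrans (invr_gt0 _) e0)).
have rk0 : 0 < r k by rewrite invr_gt0 ltr0n.
have nx : nbhs x [set y | d x y < r k] by apply/dN; exists (r k).
have [|q [qx Dq]] := dD _ _ (@open_interior _ [set y | d x y < r k]).
  by exists x.
have {}qx : d x q < r k := interior_subset qx.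
have := congr1 (fun f => f (pickle (i q, k))) exy => /= /esym eqxy.
have : `[< exists q' k', [/\ D q', pickle (i q, k) = pickle (i q', k')
                        & d y q' < r k'] >].
  by rewrite eqxy; apply/asboolP; exists q, k.
move=> /asboolP[q' [k' [Dq' /(pcan_inj pickleK)[iqq' <-] yq']]].
have {iqq'} qq' : q = q' by apply: iinj => //; exact/mem_set.
rewrite -qq' in yq'; have := dD3 x q y; apply/negP; rewrite -ltNge (dC q).
by rewrite (lt_trans (ltrD qx yq')) // (splitr (d x y)) ltrD.
Qed.

Definition card_succ {T : Type} (K : set T) : set (option T) :=
  None |` (Some @` K).

(* A graph is given by its edge set, as a set of ordered pairs. *)
Section graphs.
Context {X : topologicalType}.
Implicit Types (G : set (X * X)) (C : set X).

Definition borel_graph G : Prop :=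
  [/\ borel G, forall x, ~ G (x, x) & forall x y, G (x, y) -> G (y, x)].

Definition neighbors G (x : X) : set X := [set y | G (x, y)].

Definition adj G : rel X := fun x y => `[< G (x, y) >].

(* By irreflexivity, an odd [ucycle] has length at least 3. *)
Definition bipartite G : Prop :=
  forall p : seq X, ucycle (adj G) p -> ~~ odd (size p).

Definition component G (x : X) : set X :=
  [set y | exists2 p, path (adj G) x p & last x p = y].

Definition invariant G C : Prop :=
  exists S : set X, C = \bigcup_(x in S) component G x.

(* The edge set of the induced subgraph on C. *)
Definition induced G C : set (X * X) := G `&` (C `*` C).

Definition max_degree G : cardinal :=
  least_card [set K | forall x, neighbors G x #<= K].

Lemma max_degreeP (R : realType) G : polish R X ->
  (forall x, neighbors G x #<= max_degree G) /\
  (forall K : cardinal,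
    (forall x, neighbors G x #<= K) -> max_degree G #<= K).
Proof.
move=> polX; apply: least_cardP; exists [set: nat -> bool] => x.
exact: card_le_trans (card_leT _) (polish_card_le polX).
Qed.

(* A coloring of the unordered edges is a symmetric function on G. *)
Definition borel_edge_coloring G (Y : topologicalType) (c : G -> Y) : Prop :=
  [/\ forall B : set Y, borel B ->
        borel [set val e | e in [set e : G | B (c e)]],
      forall e f : G, val f = ((val e).2, (val e).1) -> c e = c f &
      forall e f : G, (val e).1 = (val f).1 -> e <> f -> c e <> c f].

(* The least cardinal of a Polish space Y such that G has a Borel edge coloring
   with colors in Y.  For a countable number of colors Y can be taken discrete.
   An edge coloring depends on the edge set only, so that for C Borel this also
   defines the Borel edge chromatic number of the induced subgraph on C. *)
Definition borel_edge_chromatic (R : realType) G : cardinal :=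
  least_card [set K | exists Y : topologicalType,
    [/\ polish R Y, [set: Y] #= K &
        exists c : G -> Y, borel_edge_coloring c]].

Definition baire_edge_chromatic (R : realType) G : cardinal :=
  least_card [set borel_edge_chromatic R (induced G C) |
    C in [set C | [/\ comeagre C, invariant G C & borel C]]].

End graphs.

(* Main.v *)
Require Import Defs.
From mathcomp Require Import all_boot all_order all_algebra.
From mathcomp Require Import zify lra.

(** If some vertex has continuum many neighbors, color an edge by its unordered
pair of endpoints.  Otherwise the Lusin-Novikov theorem covers G by countably many
Borel functions, which already gives a countable Borel coloring and settles the case
of infinite degrees.  Let now D = Delta(G) be finite.  A generic sequence of choices
yields, on a comeagre invariant Borel set, a family of finite tiles, nested or far
apart and exhausting every component.  The spheres around the tiles, at D
different radii, form Borel sets S_0, ..., S_(D-1) that are far from each other and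
such that both the edges meeting S_i and the edges meeting its complement span
finite components.  In a bipartite graph of maximal degree d with finite components
some Borel matching covers all vertices of degree d (Hall in each component).  So a
matching M_i made of edges meeting the complement of S_i, followed by a matching N_i
made of edges meeting S_i, reduces the maximal degree of the remaining graph by one.
After D steps no edge is left, and since the S_i are far apart, the union of all
N_i is a single matching: M_0, ..., M_(D-1) and this union are D + 1 colors. *)

(** On infinite components a matching cannot be chosen in a Borel way in general: for the graph of
    an irrational rotation of the circle, no Borel matching covers all vertices, even on a comeagre
    invariant Borel set, so that [D] colors do not suffice. On a finite component, a matching is
    coded by words read from a root, hence by a natural number, and taking the least code that works
    is Borel. Hall's theorem and the bipartition, which comes from choice and may fail to be Borel,
    only serve to show that some code works. Two matchings per step are used because only the two
    parts of the edge set have finite components. A vertex outside S_i has all its edges in the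
    first part and a vertex of S_i has all of them in the second, so a vertex of maximal degree has
    full degree in at least one part. Tiles are nested or far apart for every sequence of well
    separated sets of centers. Genericity only ensures that each vertex of the comeagre set is a
    center at some stage, so that every vertex lies in a tile. *)

Set Implicit Arguments.
Unset Strict Implicit.
Unset Printing Implicit Defensive.

(** * Matchings in finite bipartite graphs *)

Section hall.
Context {T : finType} (r : rel T).
Implicit Types S X Y : {set T}.

Let N S := [set b | [exists a in S, r a b]].

Let NU S S' : N (S :|: S') = (N S :|: N S')%SET.
Proof.
apply/setP => b; rewrite !inE; apply/existsP/orP.
  by case=> a /andP[]; rewrite inE => /orP[] aS rab; [left|right]; apply/existsP; exists a; rewrite aS.
by case=> /existsP[a /andP[aS rab]]; exists a; rewrite inE aS ?orbT.
Qed.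

(** Hall's marriage theorem, by induction on [#|X|]. If some nonempty proper subset [S] is tight,
    with exactly [#|S|] neighbors in [Y], then [S] is matched into these and the rest of [X] into
    the other points of [Y]. Otherwise each such [S] has a neighbor to spare, so that any first pair
    [x], [y] can be removed. *)
Lemma hall_on X Y : (forall S, S \subset X -> (#|S| <= #|N S :&: Y|)%N) ->
  exists f : T -> T, {in X &, injective f} /\ forall a, a \in X -> (f a \in Y) && r a (f a).
Proof.
have [n] := ubnP #|X|; elim: n X Y => // n IHn X Y Xn hallXY.
have [->|[x xX]] := set_0Vmem X; first by exists id; split=> ? ; rewrite inE.
have [/existsP[S /and4P[SX S0 SnX /eqP NS]]|tight] := boolP [exists S : {set T},
    [&& S \subset X, S != set0, S != X & #|N S :&: Y| == #|S|]].
  have SXlt : (#|S| < #|X|)%N by apply: proper_card; rewrite properEneq SnX.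
  have S1 : (0 < #|S|)%N by rewrite card_gt0.
  have [||f [finj fP]] := IHn S (N S :&: Y); first by lia.
    move=> S' S'S; rewrite setIA.
    have -> : N S' :&: N S = N S' :> {set T}.
      apply/setIidPl; apply/subsetP => b; rewrite !inE => /existsP[a /andP[aS rab]].
      by apply/existsP; exists a; rewrite (subsetP S'S).
    exact: hallXY (subset_trans S'S SX).
  have [||g [ginj gP]] := IHn (X :\: S) (Y :\: N S).
    by have := cardsID S X; rewrite (setIidPr SX); lia.
    move=> S' S'X.
    have S'S : [disjoint S & S'].
      rewrite disjoint_sym; apply/pred0P => a /=; apply/negP => /andP[/(subsetP S'X)].
      by rewrite inE => /andP[/negPf->].
    (* The condition for the rest of [X] is that of [S :|: S'] minus the contribution of the tight
       set [S]. *)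
    have := hallXY (S :|: S'); rewrite NU setIUl subUset SX.
    rewrite (subset_trans S'X (subsetDl _ _)) => /(_ isT).
    rewrite cardsU (_ : S :&: S' = set0); last by apply/eqP; rewrite setI_eq0.
    rewrite cards0 subn0 -NS => /leq_trans h; rewrite -(leq_add2l #|N S :&: Y|); apply: h.
    rewrite (_ : N S :&: Y :|: N S' :&: Y = (N S :&: Y) :|: (N S' :&: (Y :\: N S))).
      by rewrite cardsU leq_subr.
    by apply/setP => b; rewrite !in_setU !in_setI in_setD; case: (b \in N S); case: (b \in N S'); case: (b \in Y).
  exists (fun a => if a \in S then f a else g a); split.
    move=> a b aX bX /=; case: ifPn => aS; case: ifPn => bS.
    - exact: finj.
    - move=> fg; have /andP[] := gP b (ltac:(by rewrite inE bS)); rewrite -fg !inE.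
      by have /andP[] := fP a aS; rewrite !inE => /andP[->].
    - move=> fg; have /andP[] := gP a (ltac:(by rewrite inE aS)); rewrite fg !inE.
      by have /andP[] := fP b bS; rewrite !inE => /andP[->].
    - by apply: ginj; rewrite inE ?aS ?bS.
  move=> a aX; case: ifPn => aS.
    by have /andP[] := fP a aS; rewrite inE => /andP[_ ->].
  by have /andP[] := gP a (ltac:(by rewrite inE aS)); rewrite inE => /andP[_ ->].
have [y] : exists y, y \in N [set x] :&: Y.
  apply/set0Pn; rewrite -card_gt0 (leq_trans _ (hallXY [set x] _)) ?cards1 //.
  by rewrite sub1set.
rewrite !inE => /andP[/existsP[x' /andP[]]]; rewrite inE => /eqP -> rxy yY.
have [||f [finj fP]] := IHn (X :\ x) (Y :\ y).
- by have := cardsD1 x X; rewrite xX; lia.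
- move=> S SX; have [->|S0] := eqVneq S set0; first by rewrite cards0.
  have SX' : S \subset X := subset_trans SX (subD1set _ _).
  have SnX : S != X by apply: contraTneq xX => <-; apply: contraTN isT => /(subsetP SX); rewrite !inE eqxx.
  have : (#|S| < #|N S :&: Y|)%N.
    rewrite ltn_neqAle hallXY // andbT eq_sym; apply: contraNN tight => NS.
    by apply/existsP; exists S; rewrite SX' S0 SnX NS.
  by rewrite (cardsD1 y (N S :&: Y)) setIDA; case: (y \in _) => /=; lia.
exists (fun a => if a == x then y else f a); split.
  move=> a b aX bX /=; case: eqP => [->|/eqP ax]; case: eqP => [->|/eqP bx] //.
  - by move=> yf; have /andP[] := fP b (ltac:(by rewrite !inE bx)); rewrite !inE -yf eqxx.
  - by move=> yf; have /andP[] := fP a (ltac:(by rewrite !inE ax)); rewrite !inE yf eqxx.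
  - by apply: finj; rewrite !inE ?ax ?bx.
move=> a aX; case: eqP => [->|/eqP ax]; first by rewrite yY.
by have /andP[] := fP a (ltac:(by rewrite !inE ax)); rewrite !inE => /andP[_ ->].
Qed.

End hall.

(** Hall's condition by double counting: the rows of [S] have total weight [D * #|S|], all of it in
    the columns of [NS], which carry at most [D * #|NS|]. *)
Lemma regular_permutation (T : finType) (N : T -> T -> nat) D : (0 < D)%N ->
  (forall x, \sum_y N x y = D)%N -> (forall y, \sum_x N x y = D)%N ->
  exists f : T -> T, injective f /\ forall x, (0 < N x (f x))%N.
Proof.
move=> D0 rowN colN.
have [|f [finj fP]] := @hall_on T (fun x y => 0 < N x y)%N setT setT.
  move=> S _; rewrite setIT -(leq_pmul2l D0).
  set NS := finset _.
  have -> : (D * #|S| = \sum_(x in S) \sum_(y in NS) N x y)%N.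
    rewrite mulnC -sum_nat_const; apply: eq_bigr => x xS; rewrite -(rowN x).
    rewrite (bigID (mem NS)) /= [X in (_ + X)%N]big1 ?addn0 // => y.
    rewrite inE; apply: contraNeq; rewrite -lt0n => Nxy.
    by apply/existsP; exists x; rewrite xS.
  rewrite exchange_big /= mulnC -sum_nat_const; apply: leq_sum => y _.
  by rewrite -(colN y) [leqRHS](bigID (mem S)) /= leq_addr.
exists f; split=> [x y|x]; first by apply: finj; rewrite inE.
by have /andP[] := fP x (in_setT x).
Qed.

(* Loops make the adjacency matrix [D]-regular, which does not require the graph
   to be regular; a permutation in its support has no fixed point of degree [D]. *)
Lemma finite_matching (T : finType) (e : rel T) (side : T -> bool) D : (0 < D)%N ->
  symmetric e -> (forall x y, e x y -> side x != side y) ->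
  (forall x, #|[set y | e x y]| <= D)%N ->
  exists M : rel T, [/\ symmetric M, subrel M e,
    forall x y y', M x y -> M x y' -> y = y' &
    forall x, #|[set y | e x y]| = D -> exists y, M x y].
Proof.
move=> D0 esym es degD; pose deg x := #|[set y | e x y]|.
have eirr x : e x x = false by apply/negP => /es; rewrite eqxx.
pose N x y := (if x == y then D - deg x else e x y : nat)%N.
have Nsym x y : N x y = N y x by rewrite /N eq_sym esym; case: eqP => [->|].
have rowN x : (\sum_y N x y = D)%N.
  rewrite (bigD1 x) //= {1}/N eqxx -[RHS](subnK (degD x)); congr addn.
  have -> : #|[set y | e x y]| = (\sum_y e x y)%N.
    by rewrite -sum1_card big_mkcond; apply: eq_bigr => y _; rewrite inE; case: (e x y).
  rewrite [RHS](bigD1 x) //= eirr add0n; apply: eq_bigr => y yx.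
  by rewrite /N eq_sym (negPf yx).
have [|f [finj fN]] := regular_permutation D0 rowN.
  by move=> y; rewrite -(rowN y); apply: eq_bigr => x _.
have fe x : f x != x -> e x (f x).
  by move=> fx; have := fN x; rewrite /N eq_sym (negPf fx) lt0b.
have fD x : deg x = D -> f x != x.
  by move=> dx; apply/eqP => fx; have := fN x; rewrite /N fx eqxx dx subnn.
(* Only the arcs of [f] that leave side [true] are kept. A vertex of degree [D] is not fixed by [f];
   on side [true] it is matched to its image, on side [false] to its preimage. *)
exists (fun x y => (x != y) && ((side x && (f x == y)) || (side y && (f y == x)))); split.
- by move=> x y; rewrite eq_sym orbC.
- move=> x y /andP[xy /orP[/andP[_ /eqP fx]|/andP[_ /eqP fy]]].
    by rewrite -fx; apply: fe; rewrite fx eq_sym.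
  by rewrite esym -fy; apply: fe; rewrite fy.
- have h x y : (x != y) && ((side x && (f x == y)) || (side y && (f y == x))) ->
      if side x then f x = y else f y = x.
    move=> /andP[xy /orP[/andP[-> /eqP //]|/andP[sy /eqP fy]]].
    have := es y x; rewrite -{1}fy fe ?fy // sy => /(_ isT).
    by case: (side x).
  move=> x y y' /h + /h; case: (side x) => [-> //|fy fy'].
  by apply: finj; rewrite fy fy'.
- move=> x dx; have [sx|sx] := boolP (side x).
    by exists (f x); rewrite eqxx andbT eq_sym fD.
  have [g fg gf] := injF_bij finj; have gx : g x != x.
    by apply: contraNneq (fD x dx) => gx; rewrite -[X in f X]gx gf.
  exists (g x); rewrite /= gf eqxx andbT eq_sym gx /=.
  by have := fe (g x); rewrite gf eq_sym gx => /(_ isT) /es; rewrite (negPf sx); case: (side (g x)).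
Qed.

From mathcomp Require Import mathcomp_extra boolp classical_sets functions.
From mathcomp Require Import cardinality reals topology measure.

Import Order.TTheory GRing.Theory Num.Theory.

Local Open Scope classical_set_scope.
Local Open Scope card_scope.
Local Open Scope ring_scope.

(** * Borel sets and charts of Polish spaces *)

Section borel_sets.
Context {T : topologicalType}.
Implicit Types A B : set T.

Lemma borel_ind (F : set (set T)) :
  (forall U, open U -> F U) -> (forall A, F A -> F (~` A)) ->
  (forall A : nat -> set T, (forall n, F (A n)) -> F (fun x => exists n, A n x)) ->
  forall A, borel A -> F A.
Proof.
move=> Fo FC FU A; apply: smallest_sub => //; split.
- exact: Fo open0.
- by move=> B FB; rewrite setTD; exact: FC.
- move=> B FB; rewrite (_ : \bigcup_k _ = fun x => exists n, B n x); first exact: FU.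
  by apply/seteqP; split => x [n]; exists n.
Qed.

Lemma borel_open A : open A -> borel A.
Proof. exact: sub_sigma_algebra. Qed.

(** The closure properties are stated for formulas instead of set operations: a set defined by a
    formula with countable quantifiers is then shown to be Borel by following the formula. *)
Lemma borel_not A : borel A -> borel (fun x => ~ A x).
Proof. by move=> /sigma_algebraCD; rewrite setTD. Qed.

Lemma borel_exn (A : nat -> set T) :
  (forall n, borel (A n)) -> borel (fun x => exists n, A n x).
Proof.
move=> bA; rewrite (_ : (fun x => _) = \bigcup_n A n); first exact: sigma_algebra_bigcup.
by apply/seteqP; split => x [n]; exists n.
Qed.

Lemma borel_const (Q : Prop) : borel (fun _ : T => Q).
Proof.
have [q|q] := pselect Q.
  by rewrite (_ : (fun _ => Q) = setT); [exact: (borel_open openT)|apply/seteqP; split].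
by rewrite (_ : (fun _ => Q) = set0); [exact: (borel_open open0)|apply/seteqP; split].
Qed.

Lemma borel_ex (I : countType) (A : I -> set T) :
  (forall i, borel (A i)) -> borel (fun x => exists i, A i x).
Proof.
move=> bA.
rewrite (_ : (fun x => _) = fun x => exists n, if unpickle n is Some i then A i x else False).
  by apply: borel_exn => n; case: unpickle => [i|]; [exact: bA|exact: borel_const].
apply/seteqP; split => x [].
  by move=> i Ai; exists (pickle i); rewrite pickleK.
by move=> n; case: unpickle => // i; exists i.
Qed.

Lemma borel_all (I : countType) (A : I -> set T) :
  (forall i, borel (A i)) -> borel (fun x => forall i, A i x).
Proof.
move=> bA; rewrite (_ : (fun x => _) = fun x => ~ exists i, ~ A i x).
  by apply: borel_not; apply: borel_ex => i; exact: borel_not.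
apply/seteqP; split => x /=; first by move=> h [i]; apply.
by move=> h i; apply: contrapT => nA; apply: h; exists i.
Qed.

Lemma borel_or A B : borel A -> borel B -> borel (fun x => A x \/ B x).
Proof.
move=> bA bB; rewrite (_ : (fun x => _) = fun x => exists b : bool, if b then A x else B x).
  by apply: borel_ex => -[].
by apply/seteqP; split => x /=; [case=> h; [exists true|exists false]|case=> -[]; [left|right]].
Qed.

Lemma borel_and A B : borel A -> borel B -> borel (fun x => A x /\ B x).
Proof.
move=> bA bB; rewrite (_ : (fun x => _) = fun x => forall b : bool, if b then A x else B x).
  by apply: borel_all => -[].
apply/seteqP; split => x /=; first by move=> [? ?] [].
by move=> h; split; [exact: (h true)|exact: (h false)].
Qed.

Lemma borel_imp A B : borel A -> borel B -> borel (fun x => A x -> B x).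
Proof.
move=> bA bB; rewrite (_ : (fun x => _) = fun x => ~ A x \/ B x).
  by apply: borel_or => //; exact: borel_not.
apply/seteqP; split => x /=; last by case=> // nA /nA.
by move=> h; have [/h|] := pselect (A x); [right|left].
Qed.

Lemma borel_all_in (I : countType) (s : seq I) (A : I -> set T) :
  (forall i, borel (A i)) -> borel (fun x => forall i, i \in s -> A i x).
Proof.
by move=> bA; apply: borel_all => i; apply: borel_imp => //; exact: borel_const.
Qed.

Lemma borel_ex_in (I : countType) (s : seq I) (A : I -> set T) :
  (forall i, borel (A i)) -> borel (fun x => exists2 i, i \in s & A i x).
Proof.
move=> bA; rewrite (_ : (fun x => _) = fun x => exists i, i \in s /\ A i x).
  by apply: borel_ex => i; apply: borel_and => //; exact: borel_const.
by apply/seteqP; split => x [i]; [exists i|case=> ? ?; exists i].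
Qed.

End borel_sets.

Definition borel_fun {S T : topologicalType} (f : S -> T) :=
  forall A, borel A -> borel (fun x => A (f x)).

Lemma borel_fun_open {S T : topologicalType} (f : S -> T) :
  (forall U, open U -> borel (fun x => U (f x))) -> borel_fun f.
Proof.
move=> fo A; apply: (@borel_ind _ (fun A => borel (fun x => A (f x)))) => //.
- by move=> {}A; exact: borel_not.
- by move=> B bB; exact: borel_exn.
Qed.

Lemma borel_fun_id {T : topologicalType} : borel_fun (@id T).
Proof. by []. Qed.

Lemma borel_fun_comp {S T U : topologicalType} (f : S -> T) (g : T -> U) :
  borel_fun f -> borel_fun g -> borel_fun (g \o f).
Proof. by move=> bf bg A bA; exact: bf (bg A bA). Qed.

Lemma borel_fun_fst {S T : topologicalType} : borel_fun (@fst S T).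
Proof.
apply: borel_fun_open => U oU; apply: borel_open.
by have /continuousP/(_ _ oU) : continuous (@fst S T) by move=> z; exact: cvg_fst.
Qed.

Lemma borel_fun_snd {S T : topologicalType} : borel_fun (@snd S T).
Proof.
apply: borel_fun_open => U oU; apply: borel_open.
by have /continuousP/(_ _ oU) : continuous (@snd S T) by move=> z; exact: cvg_snd.
Qed.

Definition eqpre (n : nat) (a b : nat -> nat) := forall i, (i < n)%N -> a i = b i.

Lemma eqpre_le m n a b : (m <= n)%N -> eqpre n a b -> eqpre m a b.
Proof. by move=> mn h i im; apply: h; exact: leq_trans mn. Qed.

Lemma eqpre_mkseq n a b : eqpre n a b <-> mkseq a n = mkseq b n.
Proof.
split=> [h|h i ilt]; first by apply/eq_in_map => i; rewrite mem_iota => /h.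
by rewrite -(nth_mkseq 0%N a ilt) h nth_mkseq.
Qed.

Lemma take_mkseq (T : Type) (f : nat -> T) m n : (m <= n)%N -> take m (mkseq f n) = mkseq f m.
Proof. by move=> mn; rewrite /mkseq -map_take take_iota (minn_idPl _). Qed.

(** Continuity on Baire space, with finite prefixes as basic neighborhoods; [pclosed] is closedness
    for the same topology. *)
Definition pcont {T : topologicalType} (f : (nat -> nat) -> T) :=
  forall a U, nbhs (f a) U -> exists n, forall b, eqpre n a b -> U (f b).

Definition pclosed (C : set (nat -> nat)) :=
  forall a, (forall n, exists2 b, C b & eqpre n a b) -> C a.

Definition hausdorff (T : topologicalType) :=
  forall x y : T, x <> y ->
    exists U V, [/\ nbhs x U, nbhs y V & forall z, U z -> V z -> False].

(* A complete countable chart: the points of T are named by sequences, and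
   [O n m] plays the role of the m-th ball of radius 2^-n. *)
Definition coding {T : topologicalType} (th : (nat -> nat) -> T) (O : nat -> nat -> set T) :=
  [/\ pcont th, forall n m, open (O n m), forall n x, exists m, O n m x &
      forall a x, (forall n, O n (a n) x) -> th a = x].

Lemma half_exp_lt (R : realType) (e : R) : 0 < e -> exists n, 2^-1 ^+ n < e.
Proof.
move=> e0; exists (Num.truncn e^-1).+1; rewrite exprVn -[ltRHS]invrK.
rewrite ltf_pV2 ?posrE ?invr_gt0 ?exprn_gt0 //.
have /andP[_ /lt_trans] := truncn_itv (ltW (etrans (invr_gt0 _) e0)); apply.
by rewrite -natrX ltr_nat ltn_expl.
Qed.

Section polish_coding.
Context {R : realType} {T : topologicalType} (d : T -> T -> R).
Hypotheses (dm : is_metric d) (dN : metrizes d) (dC : complete_metric d).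
Variable e : nat -> T.
Hypothesis eD : forall x r, 0 < r -> exists n, d (e n) x < r.

Let d0 x : d x x = 0. Proof. by case: dm => /(_ x x)[_ ->]. Qed.
Let dsym x y : d x y = d y x. Proof. by case: dm. Qed.
Let dtri y x z : d x z <= d x y + d y z. Proof. by case: dm. Qed.
Let h (n : nat) : R := 2^-1 ^+ n.
Let h_gt0 n : 0 < h n. Proof. by rewrite exprn_gt0 // invr_gt0. Qed.
Let hS n : h n.+1 = h n / 2. Proof. by rewrite /h exprSr. Qed.
Let dge0 x y : 0 <= d x y.
Proof. by have := dtri y x x; rewrite d0 (dsym y) -mulr2n pmulrn_lge0. Qed.

Let O n m : set T := [set x | d (e m) x < h n.+2].

Let nbhs_ball x r : 0 < r -> nbhs x [set y | d x y < r].
Proof. by move=> r0; apply/dN; exists r. Qed.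

Let O_open n m : open (O n m).
Proof.
rewrite openE => x Ox; apply/dN; exists (h n.+2 - d (e m) x); first by rewrite subr_gt0.
by move=> y /= dy; rewrite /O /= (le_lt_trans (dtri x _ _)) // -ltrBrDl.
Qed.

(** A move to the next named center is refused when it is too long. Every sequence [a] thus yields a
    Cauchy sequence, which makes the chart total on Baire space. *)
Let Fixpoint y (a : nat -> nat) n : T :=
  if n is n'.+1 then
    if d (y a n') (e (a n)) < h n' then e (a n) else y a n'
  else e (a 0%N).

Let y_near a n : d (y a n) (y a n.+1) <= h n.
Proof. by rewrite /=; case: ifPn => [/ltW //|_]; rewrite d0 ltW. Qed.

Let y_far a n k : d (y a n) (y a (n + k)) <= 2 * h n - 2 * h (n + k).
Proof.
elim: k => [|k IHk]; first by rewrite addn0 d0 subrr.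
rewrite (le_trans (dtri (y a (n + k)) _ _)) //.
have := y_near a (n + k); rewrite addnS hS; lra.
Qed.

Let y_cauchy a : cauchy_seq d (y a).
Proof.
move=> r r0; have [N hN] := @half_exp_lt R (r / 4) (ltac:(by rewrite divr_gt0)).
exists N => m n Nm Nn; rewrite (le_lt_trans (dtri (y a N) _ _)) //.
rewrite -(subnKC Nm) -(subnKC Nn) (dsym _ (y a N)).
have := y_far a N (m - N); have := y_far a N (n - N).
have := h_gt0 (N + (m - N)); have := h_gt0 (N + (n - N)); rewrite -/(h N) in hN; lra.
Qed.

Let y_lim a l : y a @ \oo --> l -> forall n, d (y a n) l <= 2 * h n.
Proof.
move=> yl n; rewrite leNgt; apply/negP => lt.
have /yl[N _ hN] : nbhs l [set z | d l z < d (y a n) l - 2 * h n].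
  by apply: nbhs_ball; rewrite subr_gt0.
have /= := hN (n + N)%N (leq_addl _ _); have := y_far a n N.
have := dtri (y a (n + N)) (y a n) l; rewrite (dsym l); have := h_gt0 (n + N); lra.
Qed.

Let y_pre a b n : eqpre n.+1 a b -> y a n = y b n.
Proof.
elim: n => [|n IHn] ab /=; first by rewrite ab.
by rewrite (IHn (eqpre_le _ ab)) // ab.
Qed.

Lemma metric_coding : exists th O, @coding T th O.
Proof.
have [th thP] := choice (fun a => dC (y_cauchy a)).
exists th, O; split => //.
- move=> a U /dN[r r0 rU]; have [n hn] := @half_exp_lt R (r / 4) (ltac:(by rewrite divr_gt0)).
  exists n.+1 => b /y_pre ab; apply: rU => /=.
  have := y_lim (thP a) n; have := y_lim (thP b) n; rewrite -ab.
  have := dtri (y a n) (th a) (th b); rewrite (dsym (th a) (y a n)) -/(h n) in hn *; lra.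
- by move=> n x; apply: eD.
- move=> a x Ox.
  (* If [x] lies in all the named balls, no move is refused: consecutive centers are at distance
     less than [h n.+2 + h n.+3], which is below [h n]. *)
  have ya n : y a n = e (a n).
    elim: n => // n IHn; rewrite /= IHn ifT //.
    have := Ox n; have := Ox n.+1; rewrite /O /= !hS.
    have := dtri x (e (a n)) (e (a n.+1)); rewrite (dsym x).
    have := h_gt0 n; lra.
  case: dm => dmE _ _; apply/dmE/eqP; rewrite eq_le dge0 andbT leNgt; apply/negP => lt.
  have [n hn] := @half_exp_lt R (d (th a) x / 4) (ltac:(by rewrite divr_gt0)).
  have := y_lim (thP a) n; have := Ox n; rewrite /O /= -ya !hS.
  have := dtri (y a n) (th a) x; rewrite (dsym (th a) (y a n)) -/(h n) in hn *.
  have := h_gt0 n; lra.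
Qed.

Lemma metric_hausdorff : hausdorff T.
Proof.
move=> x z xz; have dxz : 0 < d x z.
  by rewrite lt_neqAle dge0 andbT eq_sym; apply/eqP; case: dm => dmE _ _ /dmE.
exists [set y | d x y < d x z / 2], [set y | d z y < d x z / 2].
split=> [||u /=]; try by apply: nbhs_ball; rewrite divr_gt0.
by have := dtri u x z; rewrite (dsym z); lra.
Qed.

End polish_coding.

Lemma polish_chart (R : realType) (T : topologicalType) (x0 : T) : polish R T ->
  hausdorff T /\ exists th O, @coding T th O.
Proof.
move=> [[D /countable_injP[i iinj] dD] [d [dm dN dC]]].
split; first exact: metric_hausdorff dm dN.
(* The dense set becomes a sequence by inverting the injection [i]; [x0] fills the indices outside
   its range. *)
pose e m := xget x0 [set q | D q /\ i q = m].
apply: (@metric_coding R T d dm dN dC e) => x r r0.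
have nx : nbhs x [set y | d x y < r] by apply/dN; exists r.
have [|q [qx Dq]] := dD _ _ (@open_interior _ [set y | d x y < r]); first by exists x.
exists (i q); rewrite /e; case: xgetP => [z _ [Dz iz]|/(_ q)]; last by case.
by rewrite (iinj _ _ _ _ iz) ?inE //; case: dm => _ -> _; exact: (interior_subset qx).
Qed.

Section chart.
Context {T : topologicalType} {th : (nat -> nat) -> T} {O : nat -> nat -> set T}.
Hypothesis cO : coding th O.

Definition cyl (s : seq nat) : set T := fun x => forall i, (i < size s)%N -> O i (nth 0%N s i) x.

Lemma cyl_open s : open (cyl s).
Proof.
have [_ oO _ _] := cO; rewrite openE => x sx.
have nO (i : 'I_(size s)) : nbhs x (O i (nth 0%N s i)).
  by apply: open_nbhs_nbhs; split; [exact: oO|exact: sx].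
suff : nbhs x (cyl s) by [].
by have := filter_forall (nbhs_filter x) nO; apply: filterS => y yO i ilt; exact: yO (Ordinal ilt).
Qed.

Lemma code_ext s x : cyl s x ->
  exists a, [/\ th a = x, mkseq a (size s) = s & forall n, cyl (mkseq a n) x].
Proof.
have [_ _ On Oth] := cO => sx.
have /choice[c cP] : forall n, exists m, O n m x /\ ((n < size s)%N -> m = nth 0%N s n).
  move=> n; case: (ltnP n (size s)) => ns; first by exists (nth 0%N s n); split=> //; exact: sx.
  by have [m Om] := On n x; exists m.
exists c; split; first by apply: Oth => n; have [] := cP n.
- by apply: (@eq_from_nth _ 0%N); rewrite size_mkseq // => i si; rewrite nth_mkseq //; have [_ ->] := cP i.
- by move=> n i; rewrite size_mkseq => lt; rewrite nth_mkseq //; have [] := cP i.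
Qed.

Lemma th_surj x : exists a, th a = x.
Proof. by have [//|a []] := @code_ext [::] x; exists a. Qed.

(** The last conclusion concerns all sequences that extend [t], not only those whose balls contain
    the point they name. It gives a countable base in [open_cyl], and it controls limits of nested
    stems in the Baire category theorem. *)
Lemma cyl_nbhs s x U : nbhs x U -> cyl s x -> exists t, [/\ prefix s t, (size s < size t)%N,
  cyl t x & forall a, mkseq a (size t) = t -> U (th a)].
Proof.
have [ct _ _ _] := cO => nU /code_ext[a [ax sa aO]].
have [n nP] := ct a U (ltac:(by rewrite ax)).
exists (mkseq a (maxn n (size s).+1)); split => //.
- by rewrite prefixE take_mkseq ?sa // (leq_trans (leqnSn _)) // leq_maxr.
- by rewrite size_mkseq leq_maxr.
- rewrite size_mkseq => b bE; apply: nP; apply: eqpre_le (leq_maxl n (size s).+1) _.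
  exact/eqpre_mkseq.
Qed.

Lemma open_cyl U x : nbhs x U -> exists2 t, cyl t x & cyl t `<=` U.
Proof.
move=> nU; have [//|t [_ _ tx tU]] := @cyl_nbhs [::] x U nU; exists t => // y.
by move=> /code_ext[a [<- ta _]]; exact: tU.
Qed.

(* The topology of a product is generated by countably many rectangles. *)
Lemma borel_comp2 (S : topologicalType) (A : set (T * T)) (f g : S -> T) :
  borel A -> borel_fun f -> borel_fun g -> borel (fun x => A (f x, g x)).
Proof.
move=> bA bf bg; move: A bA; apply: (@borel_fun_open _ _ (fun x => (f x, g x))) => U oU.
rewrite (_ : (fun x => _) = fun x => exists st : seq nat * seq nat,
    (cyl st.1 `*` cyl st.2 `<=` U) /\ (cyl st.1 (f x) /\ cyl st.2 (g x))).
  apply: borel_ex => -[s t]; apply: borel_and; first exact: borel_const.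
  by apply: borel_and; [apply: bf|apply: bg]; exact: (borel_open (cyl_open _)).
apply/seteqP; split => x /=; last by case=> -[s t] /= [stU [sf tg]]; apply: stU.
move=> Ux; have [[P Q] /= [nP nQ] PQ] : nbhs (f x, g x) U by exact: open_nbhs_nbhs.
have [s sf sP] := open_cyl nP; have [t tg tQ] := open_cyl nQ.
exists (s, t); split=> //= -[y z] [/sP Py /tQ Qz]; exact: PQ.
Qed.

Lemma cyl_sep x y : x <> y -> exists2 s, cyl s x & ~ cyl s y.
Proof.
have [_ _ _ Oth] := cO => xy; have [//|a [ax _ aO]] := @code_ext [::] x.
apply: contrapT => nos; apply: xy; rewrite -ax; apply: Oth => n.
apply: contrapT => nO; apply: nos; exists (mkseq a n.+1) => // ay.
by apply: nO; have := ay n; rewrite size_mkseq nth_mkseq // ; apply.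
Qed.

Lemma borel_eq (S : topologicalType) (f g : S -> T) :
  borel_fun f -> borel_fun g -> borel (fun x => f x = g x).
Proof.
move=> bf bg; rewrite (_ : (fun x => _) = fun x => forall s, cyl s (f x) -> cyl s (g x)).
  by apply: borel_all => s; apply: borel_imp; [apply: bf|apply: bg]; exact: (borel_open (cyl_open _)).
apply/seteqP; split => x /=; first by move=> ->.
by move=> h; apply: contrapT => /cyl_sep[s sf]; apply; exact: h.
Qed.

End chart.

Arguments cyl {T} O s.

(** * Analytic sets and the Lusin-Novikov theorem *)

Definition shift (a : nat -> nat) : nat -> nat := fun i => a i.+1.

(** Together with [merge], this lets a single point of Baire space carry countably many codes. *)
Definition part (n : nat) (a : nat -> nat) : nat -> nat := fun i => a (pickle (n, i)).

Definition merge (b : nat -> nat -> nat) : nat -> nat :=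
  fun k => if unpickle k is Some (n, i) then b n i else 0%N.

Lemma part_merge b n : part n (merge b) = b n.
Proof. by apply/funext => i; rewrite /part /merge pickleK. Qed.

Lemma part_cont n N : exists M, forall a b, eqpre M a b -> eqpre N (part n a) (part n b).
Proof.
exists (\max_(i < N) (pickle (n, i : nat)).+1) => a b ab i iN; apply: ab.
exact: (leq_trans _ (leq_bigmax (Ordinal iN))).
Qed.

Lemma pcont_part {T : topologicalType} n (f : (nat -> nat) -> T) :
  pcont f -> pcont (f \o part n).
Proof.
move=> cf a U /cf[N NP]; have [M MP] := part_cont n N.
by exists M => b /MP /NP.
Qed.

Lemma pcont_comp {S T : topologicalType} (f : (nat -> nat) -> S) (g : S -> T) :
  pcont f -> continuous g -> pcont (g \o f).
Proof. by move=> cf cg a U /cg /cf. Qed.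

Lemma pcont_pair {S T : topologicalType} (f : (nat -> nat) -> S) (g : (nat -> nat) -> T) :
  pcont f -> pcont g -> pcont (fun a => (f a, g a)).
Proof.
move=> cf cg a U [[P Q] /= [/cf[m mP] /cg[n nQ]] PQ].
exists (maxn m n) => b ab; apply: PQ; split=> /=.
  exact/mP/(eqpre_le (leq_maxl _ _) ab).
exact/nQ/(eqpre_le (leq_maxr _ _) ab).
Qed.

Lemma pclosedI (C D : set (nat -> nat)) : pclosed C -> pclosed D -> pclosed (C `&` D).
Proof.
by move=> cC cD a h; split; [apply: cC|apply: cD] => n; have [b [Cb Db] ab] := h n; exists b.
Qed.

Lemma pclosed_all (I : Type) (C : I -> set (nat -> nat)) :
  (forall i, pclosed (C i)) -> pclosed (fun a => forall i, C i a).
Proof. by move=> cC a h i; apply: cC => n; have [b Cb ab] := h n; exists b. Qed.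

Lemma pclosed_part n (C : set (nat -> nat)) : pclosed C -> pclosed (C \o part n).
Proof.
move=> cC a h; apply: cC => N; have [M MP] := part_cont n N.
by have [b Cb /MP ab] := h M; exists (part n b).
Qed.

Lemma pclosed_eq {T : topologicalType} (f g : (nat -> nat) -> T) :
  hausdorff T -> pcont f -> pcont g -> pclosed (fun a => f a = g a).
Proof.
move=> hT cf cg a h; apply: contrapT => /hT[U [V [/cf[m mU] /cg[n nV] UV]]].
have [b fgb ab] := h (maxn m n).
apply: (UV (f b)); first exact/mU/(eqpre_le (leq_maxl _ _) ab).
by rewrite fgb; exact/nV/(eqpre_le (leq_maxr _ _) ab).
Qed.

Definition bcyl (s : seq nat) : set (nat -> nat) := [set a | mkseq a (size s) = s].

Lemma bcyl_eqpre s a b : bcyl s a -> bcyl s b -> eqpre (size s) a b.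
Proof. by move=> sa sb; apply/eqpre_mkseq; rewrite sa sb. Qed.

Lemma bcyl_mkseq a n : bcyl (mkseq a n) a.
Proof. by rewrite /bcyl /= size_mkseq. Qed.

Lemma bcyl_mkseqP a b n : bcyl (mkseq a n) b <-> eqpre n a b.
Proof. by rewrite /bcyl /= size_mkseq; split=> [/esym/eqpre_mkseq|/eqpre_mkseq]. Qed.

Lemma pclosed_bcyl s : pclosed (bcyl s).
Proof. by move=> a /(_ (size s))[b sb /eqpre_mkseq ab]; rewrite /bcyl /= ab. Qed.

Lemma prefix_chain (s : nat -> seq nat) :
  (forall n, prefix (s n) (s n.+1) /\ (size (s n) < size (s n.+1))%N) ->
  exists a, forall n, bcyl (s n) a.
Proof.
move=> sS; have ssz n : (n <= size (s n))%N.
  by elim: n => // n /leq_ltn_trans; apply; have [] := sS n.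
have spre m n : (m <= n)%N -> prefix (s m) (s n).
  elim: n => [|n IHn]; first by rewrite leqn0 => /eqP ->; exact: prefix_refl.
  rewrite leq_eqVlt => /orP[/eqP ->|/IHn]; first exact: prefix_refl.
  by move=> /prefix_trans; apply; have [] := sS n.
exists (fun i => nth 0%N (s i.+1) i) => n.
apply: (@eq_from_nth _ 0%N); rewrite size_mkseq // => i ilt; rewrite nth_mkseq //.
have [le|/ltnW le] := leqP i.+1 n.
  by have /prefixP[w ->] := spre _ _ le; rewrite nth_cat ssz.
by have /prefixP[w ->] := spre _ _ le; rewrite nth_cat ilt.
Qed.

Section analytic_sets.
Context {T : topologicalType}.
Implicit Types A B : set T.

Definition analytic A := exists f C, [/\ pcont f, pclosed C & A = f @` C].

Lemma analytic_image {S : topologicalType} (g : T -> S) A : continuous g -> analytic A ->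
  exists f C, [/\ pcont f, pclosed C & g @` A = f @` C].
Proof.
move=> cg [f [C [cf cC ->]]]; exists (g \o f), C; split=> //; first exact: pcont_comp.
by rewrite image_comp.
Qed.

(** The first entry of a code names the index [n], the remaining ones name a point of [A n]. *)
Lemma analytic_exn (A : nat -> set T) :
  (forall n, analytic (A n)) -> analytic (fun x => exists n, A n x).
Proof.
move=> /choice[f /choice[C fC]].
exists (fun a => f (a 0%N) (shift a)), (fun a => C (a 0%N) (shift a)); split.
- move=> a U nU; have [cf _ _] := fC (a 0%N); have [n nP] := cf _ _ nU.
  exists n.+1 => b ab; rewrite -(ab 0%N) //; apply: nP => i ilt; exact: ab.
- move=> a h; have [_ cC _] := fC (a 0%N); apply: cC => n; have [b Cb ab] := h n.+1.
  by exists (shift b) => [|i ilt]; [rewrite (ab 0%N)|exact: ab].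
- apply/seteqP; split=> x /=.
    move=> [n]; have [_ _ ->] := fC n => -[a Ca <-].
    by exists (fun i => if i is j.+1 then a j else n).
  by move=> [a Ca <-]; exists (a 0%N); have [_ _ ->] := fC (a 0%N); exists (shift a).
Qed.

(** One sequence carries a code for each [A n]; that all of them name the same point is a closed
    condition, because the space is Hausdorff. *)
Lemma analytic_alln (A : nat -> set T) : hausdorff T ->
  (forall n, analytic (A n)) -> analytic (fun x => forall n, A n x).
Proof.
move=> hT /choice[f /choice[C fC]].
exists (f 0%N \o part 0), (fun a => forall n, (C n (part n a)) /\ f n (part n a) = f 0%N (part 0 a)).
split; first by apply: pcont_part; have [] := fC 0%N.
- apply: pclosed_all => n; have [cf cC _] := fC n; have [cf0 _ _] := fC 0%N.
  apply: pclosedI; first exact: pclosed_part.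
  by apply: pclosed_eq => //; exact: pcont_part.
- apply/seteqP; split=> x /=; last first.
    move=> [a aP <-] n; have [_ _ ->] := fC n; have [Ca fa] := aP n.
    by exists (part n a).
  move=> Ax; have /choice[b bP] : forall n, exists a, C n a /\ f n a = x.
    by move=> n; have := Ax n; have [_ _ ->] := fC n => -[a Ca <-]; exists a.
  exists (merge b) => [n|]; rewrite !part_merge; last by have [] := bP 0%N.
  by have [? ->] := bP n; have [_ ->] := bP 0%N.
Qed.

Variable th : (nat -> nat) -> T.
Hypotheses (cth : pcont th) (sth : forall x, exists a, th a = x) (hT : hausdorff T).

Lemma analytic_closed A : closed A -> analytic A.
Proof.
move=> cA; exists th, (A \o th); split => //; last first.
  apply/seteqP; split=> x /=; last by case=> a Aa <-.
  by move=> Ax; have [a ax] := sth x; exists a; rewrite ?ax.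
move=> a h; apply: contrapT => nA.
have /cth[n nP] : nbhs (th a) (~` A).
  by apply: open_nbhs_nbhs; split => //; exact: closed_openC.
by have [b Ab /nP] := h n.
Qed.

Lemma analytic_const (Q : Prop) : analytic (fun _ => Q).
Proof.
apply: analytic_closed; have [q|q] := pselect Q.
  by rewrite (_ : (fun _ => Q) = setT); [exact: closedT|apply/seteqP; split].
by rewrite (_ : (fun _ => Q) = set0); [exact: closed0|apply/seteqP; split].
Qed.

Lemma analytic_ex (I : countType) (A : I -> set T) :
  (forall i, analytic (A i)) -> analytic (fun x => exists i, A i x).
Proof.
move=> aA.
rewrite (_ : (fun x => _) = fun x => exists n, if unpickle n is Some i then A i x else False).
  by apply: analytic_exn => n; case: unpickle => [i|]; [exact: aA|exact: analytic_const].
apply/seteqP; split => x [].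
  by move=> i Ai; exists (pickle i); rewrite pickleK.
by move=> n; case: unpickle => // i; exists i.
Qed.

Lemma analytic_all (I : countType) (A : I -> set T) :
  (forall i, analytic (A i)) -> analytic (fun x => forall i, A i x).
Proof.
move=> aA.
rewrite (_ : (fun x => _) = fun x => forall n, if unpickle n is Some i then A i x else True).
  apply: analytic_alln => // n.
  by case: unpickle => [i|]; [exact: aA|exact: analytic_const].
apply/seteqP; split => x /= h; last by move=> i; have := h (pickle i); rewrite pickleK.
by move=> n; case: unpickle => // i; exact: h.
Qed.

Lemma analytic_and A B : analytic A -> analytic B -> analytic (fun x => A x /\ B x).
Proof.
move=> aA aB; rewrite (_ : (fun x => _) = fun x => forall b : bool, if b then A x else B x).
  by apply: analytic_all => -[].
apply/seteqP; split => x /=; first by move=> [? ?] [].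
by move=> h; split; [exact: (h true)|exact: (h false)].
Qed.

Lemma analytic_open A : open A -> analytic A.
Proof.
move=> oA; rewrite (_ : A = fun x => exists s : seq nat,
    (bcyl s `<=` A \o th) /\ (th @` bcyl s) x).
  apply: analytic_ex => s; apply: analytic_and; first exact: analytic_const.
  by exists th, (bcyl s); split=> //; exact: pclosed_bcyl.
apply/seteqP; split => x /=; last by case=> s [sA] [a /sA /= Aa <-].
move=> Ax; have [a ax] := sth x.
have /cth[n nP] : nbhs (th a) A by rewrite ax; exact: open_nbhs_nbhs.
exists (mkseq a n); split; last by exists a => //; exact: bcyl_mkseq.
by move=> b /bcyl_mkseqP /nP.
Qed.

Lemma borel_analytic A : borel A -> analytic A.
Proof.
(* Analytic sets are not closed under complements, so the induction treats a set and its complement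
   together. *)
move=> bA; suff [] : analytic A /\ analytic (~` A) by [].
move: A bA; apply: borel_ind.
- by move=> U oU; split; [exact: analytic_open|apply: analytic_closed; exact: open_closedC].
- by move=> A [? ?]; rewrite setCK.
- move=> A aA; split; first by apply: analytic_exn => n; have [] := aA n.
  rewrite (_ : ~` _ = fun x => forall n, (~` A n) x).
    by apply: analytic_all => n; have [] := aA n.
  apply/seteqP; split=> x /=; first by move=> h n An; apply: h; exists n.
  by move=> h [n]; exact: h.
Qed.

Definition borel_sep A B := exists D, [/\ borel D, A `<=` D & forall x, B x -> ~ D x].

Lemma borel_sep_cover (A B : nat -> set T) A0 B0 :
  (forall x, A0 x -> exists n, A n x) -> (forall x, B0 x -> exists n, B n x) ->
  (forall m n, borel_sep (A m) (B n)) -> borel_sep A0 B0.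
Proof.
move=> AU BU h; have /choice[D DP] m : exists D, forall n, [/\ borel (D n), A m `<=` D n & forall x, B n x -> ~ D n x].
  by have [D DP] := choice (h m); exists D.
exists (fun x => exists m, forall n, D m n x); split.
- by apply: borel_exn => m; apply: borel_all => n; have [] := DP m n.
- by move=> x /AU[m Am]; exists m => n; have [_ AD _] := DP m n; exact: AD.
- by move=> x /BU[n Bn] [m /(_ n)]; have [_ _] := DP m n; apply.
Qed.

(** If [A] and [B] cannot be separated, then by [borel_sep_cover] neither can the pieces given by
    suitable one-entry extensions of the two stems. Iterating yields branches [a] and [b] with
    [f a <> g b], and disjoint neighborhoods of these points separate the pieces of some stage after
    all. *)
Lemma lusin_separation A B : analytic A -> analytic B ->
  (forall x, A x -> B x -> False) -> borel_sep A B.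
Proof.
move=> [f [C [cf cC AE]]] [g [D [cg cD BE]]] AB; apply: contrapT => nsep.
pose As s := f @` (C `&` bcyl s); pose Bs s := g @` (D `&` bcyl s).
have /choice[F FP] : forall st : seq nat * seq nat, exists mk : nat * nat,
    ~ borel_sep (As st.1) (Bs st.2) -> ~ borel_sep (As (rcons st.1 mk.1)) (Bs (rcons st.2 mk.2)).
  move=> [s t] /=; apply: contrapT => h.
  have rc u (a : nat -> nat) : bcyl u a -> bcyl (rcons u (a (size u))) a.
    by rewrite /bcyl /= size_rcons mkseqS => ->.
  have hh m n : borel_sep (As (rcons s m)) (Bs (rcons t n)).
    by apply: contrapT => nn; apply: h; exists (m, n) => _.
  apply: h; exists (0, 0)%N => ns; exfalso; apply: ns; apply: borel_sep_cover hh.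
  - by move=> _ [a [Ca sa] <-]; exists (a (size s)), a => //; split=> //; exact: rc.
  - by move=> _ [a [Da ta] <-]; exists (a (size t)), a => //; split=> //; exact: rc.
pose st := fix st n : seq nat * seq nat := if n is n'.+1 then
  (rcons (st n').1 (F (st n')).1, rcons (st n').2 (F (st n')).2) else ([::], [::]).
pose a n := (F (st n)).1; pose b n := (F (st n)).2.
have stE n : st n = (mkseq a n, mkseq b n).
  elim: n => // n IHn; rewrite [LHS]/= {1 3}IHn /=.
  by rewrite !mkseqS.
have nst n : ~ borel_sep (As (st n).1) (Bs (st n).2).
  elim: n => [|n IHn]; last exact: FP.
  move=> [E [bE AsE BsE]]; apply: nsep; exists E; split=> //.
  - by rewrite AE => _ [c Cc <-]; apply: AsE; exists c.
  - by rewrite BE => _ [c Cc <-]; apply: BsE; exists c.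
(* If a prefix of [a] had no extension in [C], the piece of that stage would be empty, hence
   separated by [set0]. *)
have Ca : C a.
  apply: cC => n; apply: contrapT => h; apply: (nst n); rewrite stE /=.
  exists set0; split=> [||x _ []//]; first exact: (borel_open open0).
  by move=> _ [c [Cc /bcyl_mkseqP ac] <-]; apply: h; exists c.
have Db : D b.
  apply: cD => k; apply: contrapT => h; apply: (nst k); rewrite stE /=.
  exists setT; split=> //; first exact: (borel_open openT).
  by move=> _ [c [Cc /bcyl_mkseqP ac] <-] _; apply: h; exists c.
have fg : f a <> g b.
  by move=> fg; apply: (AB (f a)); [rewrite AE; exists a|rewrite BE fg; exists b].
have [U [V [/nbhs_interior nU nV UV]]] := hT fg.
have [m mU] := cf _ _ nU; have [n nV'] := cg _ _ nV.
apply: (nst (maxn m n)); rewrite stE /=.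
exists U°; split; first exact: (borel_open (@open_interior _ U)).
- by move=> _ [c [Cc /bcyl_mkseqP ac] <-]; exact/mU/(eqpre_le (leq_maxl _ _) ac).
- move=> _ [c [Dc /bcyl_mkseqP bc] <-] /interior_subset Uc; apply: (UV (g c)) => //.
  exact/nV'/(eqpre_le (leq_maxr _ _) bc).
Qed.

End analytic_sets.

(* [0] if [P] is empty. *)
Definition least (P : nat -> Prop) : nat :=
  xget 0%N [set m | P m /\ forall k, P k -> (m <= k)%N].

Lemma leastP (P : nat -> Prop) : (exists m, P m) ->
  P (least P) /\ forall k, P k -> (least P <= k)%N.
Proof.
move=> [m Pm]; rewrite /least; case: xgetP => [k -> //|none].
have ex : exists m, `[< P m >] by exists m; apply/asboolP.
case: (none (ex_minn ex)); case: ex_minnP => k /asboolP Pk kmin; split=> // j Pj.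
by apply: kmin; exact/asboolP.
Qed.

Lemma borel_least {T : topologicalType} (P : nat -> set T) m :
  (forall k, borel (P k)) -> borel (fun x => least (P^~ x) = m).
Proof.
move=> bP; rewrite (_ : (fun x => _) = fun x =>
    (P m x /\ forall k, P k x -> (m <= k)%N) \/ (m = 0%N /\ forall k, ~ P k x)).
  apply: borel_or; apply: borel_and; rewrite ?borel_const //.
  - by apply: borel_all => k; apply: borel_imp => //; exact: borel_const.
  - exact: borel_const.
  - by apply: borel_all => k; exact: borel_not.
apply/seteqP; split=> x /=.
  have [ex|nex] := pselect (exists k, P k x).
    by move=> <-; left; exact: (leastP ex).
  move=> <-; right; split; last by move=> k Pk; apply: nex; exists k.
  by rewrite /least; case: xgetP => [k _ [Pk _]|//]; case: nex; exists k.
move=> [[Pm mmin]|[-> nP]]; last first.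
  by rewrite /least; case: xgetP => [k _ [Pk _]|//]; case: (nP k).
have [|Pl lmin] := @leastP (P^~ x); first by exists m.
by apply/eqP; rewrite eqn_leq lmin // mmin.
Qed.

Section lusin_novikov.
Context {T : topologicalType} {th : (nat -> nat) -> T} {O : nat -> nat -> set T}.
Hypotheses (cO : coding th O) (hT : hausdorff T).

Let cth : pcont th. Proof. by case: cO. Qed.
Let sth : forall x, exists a, th a = x. Proof. exact: (th_surj cO). Qed.

Let th2 (a : nat -> nat) : T * T := (th (part 0 a), th (part 1 a)).
Let cth2 : pcont th2.
Proof. by apply: pcont_pair; apply: (@pcont_part _ _ th). Qed.
Let sth2 z : exists a, th2 a = z.
Proof.
case: z => x y; have [a ax] := sth x; have [b bY] := sth y.
exists (merge (fun n => if n is 0%N then a else b)).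
by rewrite /th2 !part_merge ax bY.
Qed.

Lemma hausdorff_prod : hausdorff (T * T)%type.
Proof.
move=> [x y] [x' y'] xy; have [xx|/hT[U [V [nU nV UV]]]] := pselect (x = x').
  have /hT[U [V [nU nV UV]]] : y <> y' by move=> yy; apply: xy; rewrite xx yy.
  exists (snd @^-1` U), (snd @^-1` V); split; [exact: cvg_snd|exact: cvg_snd|].
  by move=> z; exact: UV.
exists (fst @^-1` U), (fst @^-1` V); split; [exact: cvg_fst|exact: cvg_fst|].
by move=> z; exact: UV.
Qed.
Let hT2 := hausdorff_prod.

Let analytic_fst (A : set (T * T)) : analytic A -> analytic (fst @` A).
Proof. by apply: analytic_image => z; exact: cvg_fst. Qed.

Let analytic_cylinder (A : set T) : analytic A -> analytic (fun z : T * T => A z.1).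
Proof.
move=> [f [C [cf cC AE]]].
exists (fun a => (f (part 0 a), th (part 1 a))), (C \o part 0); split.
- by apply: pcont_pair; [apply: (@pcont_part _ _ f)|apply: (@pcont_part _ _ th)].
- exact: pclosed_part.
apply/seteqP; split=> [[x y]|z] /=; last by rewrite AE => -[a Ca <-]; exists (part 0 a).
rewrite AE => -[a Ca <-]; have [b <-] := sth y.
by exists (merge (fun n => if n is 0%N then a else b)); rewrite /= !part_merge.
Qed.

(* The separating sets of the two projections name the point [y] of each section. *)
Lemma analytic_functional (A : set (T * T)) : analytic A ->
  (forall x y y', A (x, y) -> A (x, y') -> y = y') ->
  exists2 g : T -> T, borel_fun g & forall x y, A (x, y) -> g x = y.
Proof.
move=> aA Afun; have [_ oO On Oth] := cO.
have bO n m : borel (fun z : T * T => O n m z.2).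
  by apply: (@borel_fun_snd T T); exact: (borel_open (oO n m)).
have /choice[D DP] (nm : nat * nat) : exists D : set T,
    [/\ borel D, forall x y, A (x, y) -> O nm.1 nm.2 y -> D x &
     forall x y, A (x, y) -> ~ O nm.1 nm.2 y -> ~ D x].
  case: nm => n m /=.
  have [||x|D [bD D1 D2]] := @lusin_separation T hT
     (fst @` (fun z => A z /\ O n m z.2)) (fst @` (fun z => A z /\ ~ O n m z.2)).
  - apply: analytic_fst; apply: (analytic_and cth2 sth2 hT2) => //.
    exact: (borel_analytic cth2 sth2 hT2 (bO n m)).
  - apply: analytic_fst; apply: (analytic_and cth2 sth2 hT2) => //.
    exact: (borel_analytic cth2 sth2 hT2 (borel_not (bO n m))).
  - move=> [[x1 y] [/= Axy Oy] <-] [[x2 y'] [/= Axy' nOy] /= xx].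
    by apply: nOy; rewrite xx in Axy'; rewrite -(Afun _ _ _ Axy Axy').
  exists D; split=> // x y Axy Oy; first by apply: D1; exists (x, y).
  by apply: D2; exists (x, y).
pose a x n := least (fun m => D (n, m) x).
have ba n m : borel (fun x => a x n = m).
  by apply: (@borel_least _ (fun m x => D (n, m) x)) => k; have [] := DP (n, k).
exists (th \o a); last first.
  move=> x y Axy; apply: Oth => n; have [m Om] := On n y.
  have [|Da _] := @leastP (fun m => D (n, m) x).
    by exists m; have [_ D1 _] := DP (n, m); exact: D1 Om.
  apply: contrapT => nO; have [_ _ D2] := DP (n, a x n).
  exact: (D2 _ _ Axy nO).
apply: borel_fun_open => U oU; rewrite (_ : (fun x => _) = fun x => exists s : seq nat,
    (bcyl s `<=` U \o th) /\ bcyl s (a x)).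
  apply: borel_ex => s; apply: borel_and; first exact: borel_const.
  rewrite (_ : (fun x => _) = fun x => forall i : 'I_(size s), a x i = nth 0%N s i).
    exact: borel_all.
  apply/seteqP; split=> x /=.
    move=> ax i; have := congr1 (fun u => nth 0%N u i) ax.
    by rewrite nth_mkseq.
  move=> ax; apply: (@eq_from_nth _ 0%N); rewrite size_mkseq // => i ilt.
  by rewrite nth_mkseq // (ax (Ordinal ilt)).
apply/seteqP; split => x /=; last by case=> s [sU] /sU.
move=> Ux; have [n nP] := cth (open_nbhs_nbhs (conj oU Ux)).
exists (mkseq (a x) n); split; last exact: bcyl_mkseq.
by move=> b /bcyl_mkseqP /nP.
Qed.

Definition covered (g : nat -> T -> T) : set (T * T) := fun z => exists n, g n z.1 = z.2.

Let covered_borel g : (forall n, borel_fun (g n)) -> borel (covered g).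
Proof.
move=> bg; apply: borel_exn => n; apply: (borel_eq cO); last exact: borel_fun_snd.
exact: borel_fun_comp borel_fun_fst (bg n).
Qed.

Section dichotomy.
Variables (f : (nat -> nat) -> T * T) (C : set (nat -> nat)).
Hypotheses (cf : pcont f) (cC : pclosed C).

Let cf1 : pcont (fst \o f).
Proof. by apply: pcont_comp => // z; exact: cvg_fst. Qed.
Let cf2 : pcont (snd \o f).
Proof. by apply: pcont_comp => // z; exact: cvg_snd. Qed.

Let P (s : seq nat) (g : nat -> T -> T) : set T :=
  fun x => exists a, [/\ C a, bcyl s a, (f a).1 = x & ~ covered g (f a)].

(** This replaces uncountability in a perfect set construction: after removal of any countable
    family of Borel graphs, all stems of [u] still have points over one common [x]. The common [x]
    is what puts the whole Cantor set into a single section. *)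
Let good (u : seq (seq nat)) := forall g, (forall n, borel_fun (g n)) ->
  exists x, forall s, s \in u -> P s g x.

Let P_analytic s g : (forall n, borel_fun (g n)) -> analytic (P s g).
Proof.
move=> bg; rewrite (_ : P s g = fst @` (fun z => (f @` (C `&` bcyl s)) z /\ ~ covered g z)).
  apply: analytic_fst; apply: (analytic_and cth2 sth2 hT2).
    by exists f, (C `&` bcyl s); split=> //; apply: pclosedI => //; exact: pclosed_bcyl.
  exact: (borel_analytic cth2 sth2 hT2 (borel_not (covered_borel bg))).
apply/seteqP; split=> x.
  by move=> [a [Ca sa <- na]]; exists (f a) => //; split=> //; exists a.
by move=> [z [[a [Ca sa] <-] na] <-]; exists a.
Qed.

Let P_sub s g g' : covered g `<=` covered g' -> P s g' `<=` P s g.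
Proof. by move=> gg x [a [Ca sa xa na]]; exists a; split=> // /gg. Qed.

Let splits (s s1 s2 : seq nat) := [/\ prefix s s1, prefix s s2,
  (size s < size s1)%N, (size s < size s2)%N &
  forall a b, bcyl s1 a -> bcyl s2 b -> (f a).2 <> (f b).2].

(* If every split were bad, one countable family of functions would witness it
   for all of them, and outside this family the fibers over a fixed stem would be
   single points, hence would lie on the graph of one more Borel function. *)
Let good_split s v : good (s :: v) -> exists s1 s2, splits s s1 s2 /\ good (s1 :: s2 :: v).
Proof.
move=> gs; apply: contrapT => ns.
have /choice[g gP] (e : seq nat * seq nat) : exists g : nat -> T -> T,
    (forall n, borel_fun (g n)) /\ (splits s e.1 e.2 ->
    forall x, ~ forall r, r \in [:: e.1, e.2 & v] -> P r g x).
  have [se|nse] := pselect (splits s e.1 e.2); last first.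
    by exists (fun _ => id); split=> [n|//]; exact: borel_fun_id.
  apply: contrapT => ng; apply: ns; exists e.1, e.2; split=> // g bg.
  by apply: contrapT => nx; apply: ng; exists g; split=> // _ x xP; apply: nx; exists x.
pose G n := if unpickle n is Some (e, k) then g e k else id.
have bG n : borel_fun (G n).
  by rewrite /G; case: unpickle => [[e k]|]; [have [] := gP e|exact: borel_fun_id].
have gG e : covered (g e) `<=` covered G.
  by move=> z [n nz]; exists (pickle (e, n)); rewrite /G pickleK.
(* The points reached from the stem [s] that [G] leaves uncovered, over those [x] at which the other
   stems [v] survive. *)
pose D : set (T * T) := fun z => ((f @` (C `&` bcyl s)) z /\ ~ covered G z) /\
  forall r : seq nat, (fun z : T * T => r \in v -> P r G z.1) z.
have aD : analytic D.
  apply: (analytic_and cth2 sth2 hT2).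
    apply: (analytic_and cth2 sth2 hT2).
      by exists f, (C `&` bcyl s); split=> //; apply: pclosedI => //; exact: pclosed_bcyl.
    exact: (borel_analytic cth2 sth2 hT2 (borel_not (covered_borel bG))).
  apply: (analytic_all cth2 sth2 hT2) => r; have [rv|rv] := boolP (r \in v).
    rewrite (_ : (fun z => _) = fun z => P r G z.1).
      by apply: analytic_cylinder; exact: P_analytic.
    by apply/seteqP; split=> z //= ; apply.
  rewrite (_ : (fun z => _) = fun=> True); first exact: (analytic_const cth2 sth2).
  by apply/seteqP; split.
(* Two distinct points over the same [x] would give long prefixes that split [s], and [x] would
   contradict the family attached to that split, since [G] contains it. *)
have Dfun x y y' : D (x, y) -> D (x, y') -> y = y'.
  move=> [[[a [Ca sa] fa] na] vP] [[[b [Cb sb] fb] nb] _].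
  apply: contrapT => /hT[U [V [nU nV UV]]].
  have [|m mU] := cf2 (a := a) (U := U); first by rewrite /= fa.
  have [|n nV'] := cf2 (a := b) (U := V); first by rewrite /= fb.
  pose N := maxn (size s).+1 (maxn m n).
  have pre c : bcyl s c -> prefix s (mkseq c N).
    by move=> sc; rewrite prefixE take_mkseq ?sc // (leq_trans _ (leq_maxl _ _)).
  have mN : (m <= N)%N by rewrite /N; lia.
  have nN : (n <= N)%N by rewrite /N; lia.
  have sE : splits s (mkseq a N) (mkseq b N).
    split; rewrite ?size_mkseq ?leq_maxl //; try exact: pre.
    move=> a' b' /bcyl_mkseqP/(eqpre_le mN)/mU Ua /bcyl_mkseqP/(eqpre_le nN)/nV' Vb ab.
    by apply: (UV _ Ua); rewrite /= ab.
  have [_ /(_ sE x)] := gP (mkseq a N, mkseq b N); apply=> r.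
  rewrite !inE => /or3P[/eqP->|/eqP->|rv].
  - by apply: (P_sub (gG _)); exists a; rewrite fa; split=> //; exact: bcyl_mkseq.
  - by apply: (P_sub (gG _)); exists b; rewrite fb; split=> //; exact: bcyl_mkseq.
  - by apply: (P_sub (gG _)); exact: vP.
have [h bh hP] := analytic_functional aD Dfun.
(* Adding [h] covers [D] as well, so the goodness of [s :: v] fails for [H]. *)
pose H n := if n is n'.+1 then G n' else h.
have GH : covered G `<=` covered H by move=> z [n nz]; exists n.+1.
have [|x xP] := gs H; first by case.
have [a [Ca sa ax na]] := xP s (mem_head _ _).
apply: (na); exists 0%N => /=; apply: hP; rewrite -surjective_pairing; split.
  by split; [exists a|move=> /GH].
by move=> r rv; rewrite ax; apply: (P_sub GH); apply: xP; rewrite inE rv orbT.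
Qed.

Let good_perm u v : u =i v -> good u -> good v.
Proof. by move=> uv gu g /gu[x xP]; exists x => s; rewrite -uv; exact: xP. Qed.

Let good_splits (I : eqType) (L : seq I) (t : I -> seq nat) v : uniq L -> good (map t L ++ v) ->
  exists t0 t1, good (map t0 L ++ map t1 L ++ v) /\ forall l, l \in L -> splits (t l) (t0 l) (t1 l).
Proof.
elim: L v => [|l L IHL] v /=; first by move=> _ gv; exists t, t.
move=> /andP[lL uL] /good_split[s0 [s1 [sp g1]]].
have [|t0 [t1 [g01 sp01]]] := IHL [:: s0, s1 & v] uL.
  by apply: good_perm g1 => s; rewrite !(inE, mem_cat); case: (s == s0); case: (s == s1); rewrite ?orbT.
pose ext (u : I -> seq nat) s0 i := if i == l then s0 else u i.
have extE u s : map (ext u s) L = map u L.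
  apply/eq_in_map => i iL; rewrite /ext; case: eqP => // il.
  by rewrite il in iL; rewrite iL in lL.
exists (ext t0 s0), (ext t1 s1); split.
  apply: good_perm g01 => s; rewrite !extE /ext eqxx !(inE, mem_cat).
  by case: (s == s0); case: (s == s1); rewrite ?orbT.
by move=> i; rewrite inE /ext; case: eqP => [->|_ /=]; [|exact: sp01].
Qed.

Let lv := fix lv n : seq (seq bool) :=
  if n is n'.+1 then map (cons false) (lv n') ++ map (cons true) (lv n') else [:: [::]].

Let lv_uniq n : uniq (lv n).
Proof.
elim: n => //= n IHn; rewrite cat_uniq !map_inj_uniq ?IHn /=; try by move=> ? ? [].
by rewrite andbT; apply/hasPn => l /mapP[k _ ->]; apply/mapP => -[].
Qed.

(** The initial segment of [b] in reverse order, so that lengthening it is a [cons], as in [lv]. *)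
Let node (b : nat -> bool) := fix node n := if n is n'.+1 then b n' :: node n' else [::].

Let node_lv b n : node b n \in lv n.
Proof.
elim: n => //= n IHn; rewrite mem_cat; apply/orP.
by case: (b n); [right|left]; exact: map_f.
Qed.

(** A fusion argument: all stems of a level are split while the level stays good. Each level has one
    [x] served by all its stems, so by continuity all branches have the same first coordinate; the
    splits make the second coordinates distinct, and closedness keeps the branches in [C]. *)
Let cantor_section : good [:: [::]] -> exists x (h : (nat -> bool) -> T),
  injective h /\ forall b, (f @` C) (x, h b).
Proof.
move=> g0.
have /choice[F FP] (nt : nat * (seq bool -> seq nat)) : exists t', good (map nt.2 (lv nt.1)) ->
    good (map t' (lv nt.1.+1)) /\
    forall l, l \in lv nt.1 -> splits (nt.2 l) (t' (false :: l)) (t' (true :: l)).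
  case: nt => n t /=; have [gt|ngt] := pselect (good (map t (lv n))); last by exists t.
  have [|t0 [t1 [g01 sp]]] := @good_splits _ _ t [::] (lv_uniq n); first by rewrite cats0.
  exists (fun l => if l is b :: l' then (if b then t1 l' else t0 l') else [::]) => _; split=> //.
  by rewrite cats0 in g01; rewrite map_cat -!map_comp.
pose t := fix t n : seq bool -> seq nat := if n is n'.+1 then F (n', t n') else fun=> [::].
have tS n : t n.+1 = F (n, t n) by [].
have gt n : good (map (t n) (lv n)).
  by elim: n => [//|n IHn]; rewrite tS; have [] := FP (n, t n) IHn.
have spt n l : l \in lv n -> splits (t n l) (t n.+1 (false :: l)) (t n.+1 (true :: l)).
  by move=> ln; rewrite tS; have [_ +] := FP (n, t n) (gt n); exact.
pose s b n := t n (node b n).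
have sS b n : prefix (s b n) (s b n.+1) /\ (size (s b n) < size (s b n.+1))%N.
  by rewrite /s [node b n.+1]/=; have [? ? ? ? _] := spt n _ (node_lv b n); case: (b n).
have /choice[a sa] b := prefix_chain (sS b).
have ssz b n : (n <= size (s b n))%N.
  by elim: n => // n /leq_ltn_trans; apply; have [] := sS b n.
have PP n b : exists2 x, P (s b n) (fun=> id) x & forall b', P (s b' n) (fun=> id) x.
  have [_|x xP] := gt n (fun=> id); first exact: borel_fun_id.
  exists x; first by apply: xP; apply: map_f; exact: node_lv.
  by move=> b'; apply: xP; apply: map_f; exact: node_lv.
have Ca b : C (a b).
  apply: cC => n; have [x [c [Cc sc _ _]] _] := PP n b; exists c => //.
  exact: eqpre_le (ssz b n) (bcyl_eqpre (sa b n) sc).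
have a1 b b' : (f (a b)).1 = (f (a b')).1.
  apply: contrapT => /hT[U [V [/cf1[m mU] /cf1[n nV] UV]]].
  have [x _ xP] := PP (maxn m n) b.
  have [c [_ sc cx _]] := xP b; have [c' [_ sc' cx' _]] := xP b'.
  apply: (UV x); [rewrite -cx; apply: mU|rewrite -cx'; apply: nV].
    exact: eqpre_le (leq_trans (leq_maxl _ _) (ssz _ _)) (bcyl_eqpre (sa b _) sc).
  exact: eqpre_le (leq_trans (leq_maxr _ _) (ssz _ _)) (bcyl_eqpre (sa b' _) sc').
pose b0 := fun _ : nat => false.
exists (f (a b0)).1, (fun b => (f (a b)).2); split; last first.
  by move=> b; exists (a b) => //; rewrite (a1 b0 b) -surjective_pairing.
move=> b b' bb; apply: contrapT => nbb.
have [i ni] : exists i, b i != b' i.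
  by apply: contrapT => h; apply: nbb; apply/funext => i; apply: contrapT => /eqP ne; apply: h; exists i.
have [j nj jmin] := @ex_minnP (fun i => b i != b' i) (ex_intro _ i ni).
have nE : node b j = node b' j.
  have : forall k, (k < j)%N -> b k = b' k.
    by move=> k; apply: contraTeq => /jmin; rewrite -leqNgt.
  by elim: j {nj jmin} => //= k IHk e; rewrite e // IHk // => l lk; apply: e; rewrite ltnW.
have [_ _ _ _ sep] := spt j _ (node_lv b j).
have := sa b j.+1; have := sa b' j.+1; rewrite /s /= -nE.
by move: nj; case: (b j); case: (b' j) => // _ h1 h2; [apply: (sep _ _ h1 h2)|apply: (sep _ _ h2 h1)].
Qed.

Lemma graph_dichotomy :
  (exists g, (forall n, borel_fun (g n)) /\ f @` C `<=` covered g) \/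
  exists x (h : (nat -> bool) -> T), injective h /\ forall b, (f @` C) (x, h b).
Proof.
have [/cantor_section|ng] := pselect (good [:: [::]]); [by right|left].
apply: contrapT => nc; apply: ng => g bg; apply: contrapT => nx; apply: nc.
exists g; split=> // _ [a Ca <-]; apply: contrapT => na; apply: nx.
by exists (f a).1 => s; rewrite inE => /eqP ->; exists a.
Qed.

End dichotomy.

(* A form of the Lusin-Novikov theorem that contains the perfect set theorem. *)
Theorem lusin_novikov (G : set (T * T)) : borel G ->
  (exists g : nat -> T -> T, (forall n, borel_fun (g n)) /\
     forall x y, G (x, y) -> exists n, g n x = y) \/
  exists x (h : (nat -> bool) -> T), injective h /\ forall b, G (x, h b).
Proof.
move=> /(borel_analytic cth2 sth2 hT2)[f [C [cf cC ->]]].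
have [[g [bg gP]]|] := graph_dichotomy cf cC; last by right.
by left; exists g; split=> // x y /gP.
Qed.

End lusin_novikov.

(** * Baire category *)

Section meagre_sets.
Context {T : topologicalType}.
Implicit Types A B : set T.

Lemma nowhere_dense_sub A B : A `<=` B -> nowhere_dense B -> nowhere_dense A.
Proof.
move=> AB nB; apply/seteqP; split=> // x.
by move/(interiorS (closureS AB)); rewrite nB.
Qed.

Lemma meagre_sub A B : A `<=` B -> meagre B -> meagre A.
Proof.
move=> AB [F nF BE]; exists (fun n => F n `&` A).
  by move=> n; apply: nowhere_dense_sub (nF n) => x [].
apply/seteqP; split=> x; last by case=> n _ [].
by move=> Ax; have := AB _ Ax; rewrite BE => -[n _ Fx]; exists n.
Qed.

Lemma meagre_ex (I : countType) (A : I -> set T) :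
  (forall i, meagre (A i)) -> meagre (fun x => exists i, A i x).
Proof.
move=> mA; have /choice[F FP] i : exists F : nat -> set T,
    (forall n, nowhere_dense (F n)) /\ A i = \bigcup_n F n.
  by have [F nF AE] := mA i; exists F.
exists (fun n => if unpickle n is Some (i, k) then F i k else set0).
  move=> n; case: unpickle => [[i k]|]; first by have [] := FP i.
  by rewrite /nowhere_dense closure0 -subset0; exact: interior_subset.
apply/seteqP; split=> x.
  by move=> [i]; have [_ ->] := FP i => -[k _ Fk]; exists (pickle (i, k)) => //; rewrite pickleK.
by move=> [n _]; case: unpickle => // -[i k] Fk; exists i; have [_ ->] := FP i; exists k.
Qed.

Lemma meagreU A B : meagre A -> meagre B -> meagre (fun x => A x \/ B x).
Proof.
move=> mA mB; have : meagre (fun x => exists b : bool, if b then A x else B x).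
  by apply: meagre_ex => -[].
by apply: meagre_sub => x [] h; [exists true|exists false].
Qed.

Lemma meagre_nowhere_dense A : nowhere_dense A -> meagre A.
Proof.
move=> nA; exists (fun=> A) => //.
by apply/seteqP; split=> x; [exists 0%N|case].
Qed.

End meagre_sets.

Lemma meagre0 {T : topologicalType} : meagre (@set0 T).
Proof.
by apply: meagre_nowhere_dense; rewrite /nowhere_dense closure0 -subset0; exact: interior_subset.
Qed.

Section baire_category.
Context {T : topologicalType} {th : (nat -> nat) -> T} {O : nat -> nat -> set T}.
Hypothesis cO : coding th O.
Implicit Types (E U V : set T).

(** The Baire category theorem. The stems are extended so as to avoid the sets [F n] one after the
    other; the point named by their union avoids all of them, by the last conclusion of
    [cyl_nbhs]. *)
Lemma open_not_meagre U : open U -> U !=set0 -> ~ meagre U.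
Proof.
move=> oU [x0 Ux0] [F nF UE].
have /choice[g gP] (nt : nat * seq nat) : exists t', cyl O nt.2 !=set0 ->
    [/\ prefix nt.2 t', (size nt.2 < size t')%N, cyl O t' !=set0 &
        forall a, bcyl t' a -> ~ F nt.1 (th a)].
  case: nt => n t /=; have [[x tx]|nt] := pselect (cyl O t !=set0); last by exists t.
  have [y [ty ny]] : exists y, cyl O t y /\ ~ closure (F n) y.
    apply: contrapT => h; suff : set0 x by [].
    rewrite -(nF n); apply: (filterS _ (open_nbhs_nbhs (conj (cyl_open cO t) tx))) => y ty.
    by apply: contrapT => ny; apply: h; exists y.
  have nyF : nbhs y (~` closure (F n)).
    by apply: open_nbhs_nbhs; split=> //; apply: closed_openC; exact: closed_closure.
  have [t' [tt' st' yt' t'F]] := cyl_nbhs cO nyF ty.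
  by exists t' => _; split=> //; [exists y|move=> a /t'F + /subset_closure].
have nU : nbhs x0 U by exact: open_nbhs_nbhs.
have [//|t0 [_ _ t0x t0U]] := @cyl_nbhs _ _ _ cO [::] _ _ nU.
pose t := fix t n := if n is n'.+1 then g (n', t n') else t0.
have tn0 n : cyl O (t n) !=set0.
  by elim: n => [|n IHn]; [exists x0|have [] := gP (n, t n) IHn].
have [a ta] : exists a, forall n, bcyl (t n) a.
  by apply: prefix_chain => n; have [] := gP (n, t n) (tn0 n).
have : U (th a) by exact: t0U (ta 0%N).
by rewrite UE => -[n _]; have [_ _ _ /(_ a (ta n.+1))] := gP (n, t n) (tn0 n).
Qed.

(** A local form of the Baire property: below any nonempty open set there is one in which [E] is
    comeagre or meagre. *)
Definition decisive E := forall V, open V -> V !=set0 ->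
  exists V', [/\ open V', V' !=set0, V' `<=` V & meagre (V' `\` E) \/ meagre (V' `&` E)].

(** The points of [V] that lie in no basic open set where [E] is meagre form a nowhere dense set
    [N]; there are only countably many basic open sets to account for the rest. *)
Lemma decisive_meagre E V : decisive E -> open V ->
  (forall V', open V' -> V' !=set0 -> V' `<=` V -> ~ meagre (V' `\` E)) ->
  meagre (V `&` E).
Proof.
move=> dE oV nm.
pose N : set T := fun x => V x /\ forall s, meagre (cyl O s `&` E) -> ~ cyl O s x.
have nN : nowhere_dense N.
  apply/seteqP; split=> // y Oy.
  have [z [[Vz _] Oz]] := interior_subset Oy _ (nbhs_interior Oy).
  have [||V' [oV' [w V'w] V'V mV']] := dE ((closure N)° `&` V).
  - by apply: openI => //; exact: open_interior.
  - by exists z.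
  have [s sw sV'] := open_cyl cO (open_nbhs_nbhs (conj oV' V'w)).
  have V'V2 : V' `<=` V by move=> u /V'V[].
  case: mV' => [|mV']; first by apply: nm => //; exists w.
  have ms : meagre (cyl O s `&` E) by apply: meagre_sub mV' => u [/sV'].
  have Nw : closure N w by have [/interior_subset] := V'V _ V'w.
  have [u [[_ Nu] su]] := Nw _ (open_nbhs_nbhs (conj (cyl_open cO s) sw)).
  exact: Nu su.
apply: (@meagre_sub _ _ (fun x => N x \/ exists s, meagre (cyl O s `&` E) /\ (cyl O s `&` E) x)).
  move=> x [Vx Ex]; have [Nx|nNx] := pselect (N x); [by left|right].
  apply: contrapT => h; apply: nNx; split=> // s ms sx.
  by apply: h; exists s.
apply: meagreU; first exact: meagre_nowhere_dense.
apply: meagre_ex => s; have [ms|nms] := pselect (meagre (cyl O s `&` E)).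
  by apply: meagre_sub ms => x [].
by apply: meagre_sub meagre0 => x [].
Qed.

Lemma borel_decisive E : borel E -> decisive E.
Proof.
move: E; apply: borel_ind.
- move=> U oU V oV V0; have [UV|nUV] := pselect (V `&` U !=set0).
    exists (V `&` U); split=> //; first exact: openI.
    by left; apply: meagre_sub meagre0 => x [[_ +]].
  exists V; split=> //; right; apply: meagre_sub meagre0 => x VUx.
  by apply: nUV; exists x.
- move=> A dA V oV /(dA _ oV)[V' [oV' V'0 V'V mV']]; exists V'; split=> //.
  case: mV' => mV'; [right|left]; first by apply: meagre_sub mV' => x.
  by apply: meagre_sub mV' => x [V'x /contrapT].
- move=> A dA V oV V0.
  have [[k [W [oW W0 WV mW]]]|h] := pselect (exists k W,
      [/\ open W, W !=set0, W `<=` V & meagre (W `\` A k)]).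
    exists W; split=> //; left; apply: meagre_sub mW => x [Wx nA]; split=> // Ak.
    by apply: nA; exists k.
  exists V; split=> //; right.
  (* No [A k] is comeagre in an open part of [V], so each is meagre in [V], and so is their
     union. *)
  have : meagre (fun x => exists k, (V `&` A k) x).
    apply: meagre_ex => k; apply: decisive_meagre => // W oW W0 WV mW.
    by apply: h; exists k, W.
  by apply: meagre_sub => x [Vx [k Ak]]; exists k.
Qed.

Lemma borel_cover_comeagre (E : nat -> set T) V :
  (forall k, borel (E k)) -> open V -> V !=set0 -> (forall x, exists k, E k x) ->
  exists k V', [/\ open V', V' !=set0, V' `<=` V & meagre (V' `\` E k)].
Proof.
move=> bE oV V0 EU; apply: contrapT => h; apply: (open_not_meagre oV V0).
have : meagre (fun x => exists k, (V `&` E k) x).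
  apply: meagre_ex => k; apply: decisive_meagre => //; first exact: borel_decisive.
  by move=> W oW W0 WV mW; apply: h; exists k, W.
by apply: meagre_sub => x Vx; have [k Ek] := EU x; exists k.
Qed.

(* The [n]-th choice takes care of one requirement on one basic open set. *)
Lemma generic_choice (E : nat -> nat -> nat -> set T) :
  (forall r n k, borel (E r n k)) -> (forall r n x, exists k, E r n k x) ->
  exists p : nat -> nat, comeagre (fun x => forall r, exists n, E r n (p n) x).
Proof.
move=> bE EU.
have /choice[p pP] (n : nat) : exists k, forall r s, unpickle n = Some (r, s) -> cyl O s !=set0 ->
    exists V', [/\ open V', V' !=set0, V' `<=` cyl O s & meagre (V' `\` E r n k)].
  case nE: (unpickle n) => [[r s]|]; last by exists 0%N.
  have [s0|s0] := pselect (cyl O s !=set0); last by exists 0%N => ? ? [_ <-].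
  have [k kP] := borel_cover_comeagre (bE r n) (cyl_open cO s) s0 (EU r n).
  by exists k => ? ? [<- <-].
exists p.
have [V VP] : exists V : nat -> seq nat -> set T, forall r s, cyl O s !=set0 ->
    [/\ open (V r s), V r s !=set0, V r s `<=` cyl O s &
    meagre (V r s `\` E r (pickle (r, s)) (p (pickle (r, s))))].
  have /choice[V VP] (rs : nat * seq nat) : exists W, cyl O rs.2 !=set0 ->
      [/\ open W, W !=set0, W `<=` cyl O rs.2 &
      meagre (W `\` E rs.1 (pickle rs) (p (pickle rs)))].
    case: rs => r s; have [s0|s0] := pselect (cyl O s !=set0); last by exists set0.
    by have [|V' V'P] := pP (pickle (r, s)) r s _ s0; [rewrite pickleK|exists V'].
  by exists (fun r s => V (r, s)) => r s s0; exact: (VP (r, s)).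
apply: (@meagre_sub _ _ (fun x => exists r, ~ exists n, E r n (p n) x)).
  by move=> x nx; apply: contrapT => h; apply: nx => r; apply: contrapT => nr; apply: h; exists r.
apply: meagre_ex => r.
(* Each nonempty basic open set contains some [V r s], so the points missed by all of them are
   nowhere dense. *)
pose N : set T := fun x => forall s, cyl O s !=set0 -> ~ V r s x.
have nN : nowhere_dense N.
  apply/seteqP; split=> // y /(open_cyl cO)[s sy sN].
  have s0 : cyl O s !=set0 by exists y.
  have [oV [w Vw] Vs _] := VP r s s0.
  have [u [Nu Vu]] := sN _ (Vs _ Vw) _ (open_nbhs_nbhs (conj oV Vw)).
  exact: Nu Vu.
apply: (@meagre_sub _ _ (fun x => N x \/
    exists s, cyl O s !=set0 /\ (V r s `\` E r (pickle (r, s)) (p (pickle (r, s)))) x)).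
  move=> x nx; have [Nx|nNx] := pselect (N x); [by left|right].
  apply: contrapT => h; apply: nNx => s s0 Vx; apply: h; exists s; split=> //; split=> // Ex.
  by apply: nx; exists (pickle (r, s)).
apply: meagreU; first exact: meagre_nowhere_dense.
apply: meagre_ex => s; have [s0|s0] := pselect (cyl O s !=set0).
  by have [_ _ _] := VP r s s0; apply: meagre_sub => x [].
by apply: meagre_sub meagre0 => x [].
Qed.

End baire_category.

(** * Matchings on finite sets of vertices and the bipartition of a graph without odd cycles *)

Lemma seq_matching (X : choiceType) (H : X -> X -> Prop) (side : X -> bool) (F : seq X) D :
  (0 < D)%N -> (forall x y, H x y -> H y x) -> (forall x y, H x y -> side x <> side y) ->
  (forall x s, uniq s -> (forall y, y \in s -> H x y) -> size s <= D)%N ->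
  exists M : X -> X -> Prop, [/\ forall x y, M x y -> [/\ M y x, H x y, x \in F & y \in F],
    forall x y y', M x y -> M x y' -> y = y' &
    forall x s, x \in F -> uniq s -> size s = D ->
      (forall y, y \in s -> y \in F /\ H x y) -> exists y, M x y].
Proof.
move=> D0 Hsym Hs Hdeg.
pose e : rel (seq_sub F) := fun x y => `[< H (val x) (val y) >].
have degE (x : seq_sub F) : exists s : seq X, [/\ uniq s, size s = #|[set y | e x y]%SET| &
    forall y, y \in s -> H (val x) y].
  exists [seq val y | y <- enum [set y | e x y]%SET]; split.
  - by rewrite (map_inj_uniq val_inj) enum_uniq.
  - by rewrite size_map -cardE.
  - by move=> y /mapP[z]; rewrite mem_enum inE => /asboolP Hz ->.
have [||x|M [Msym Me Mfun MD]] := @finite_matching _ e (side \o val) D D0.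
- by move=> x y; apply/asboolP/asboolP; exact: Hsym.
- by move=> x y /asboolP /Hs /eqP.
- by have [s [us <- sH]] := degE x; exact: Hdeg sH.
exists (fun x y => exists x' y' : seq_sub F, [/\ val x' = x, val y' = y & M x' y']); split.
- move=> _ _ [x [y [<- <- xy]]]; split; [|exact/asboolP/(Me _ _ xy)|exact: valP|exact: valP].
  by exists y, x; rewrite Msym.
- move=> _ _ _ [x [y [<- <- xy]]] [x' [y' [/val_inj -> <- xy']]].
  by congr val; exact: Mfun xy xy'.
- move=> x s xF us sD sH; have [|y xy] := MD (SeqSub xF); last by exists (val y), (SeqSub xF), y.
  apply/eqP; rewrite eqn_leq; apply/andP; split.
    by have [t [ut <- tH]] := degE (SeqSub xF); exact: Hdeg tH.
  rewrite -sD cardE -(size_map val); apply: uniq_leq_size => // y ys.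
  have [yF Hy] := sH _ ys; apply/mapP; exists (SeqSub yF) => //.
  by rewrite mem_enum inE; exact/asboolP.
Qed.

Section bipartite.
Context {X : topologicalType} (G : set (X * X)).
Hypotheses (Gsym : forall x y, G (x, y) -> G (y, x)) (bG : bipartite G).

(** The hypothesis only concerns cycles without repetition. A closed walk that repeats a vertex is
    cut there into two shorter closed walks. *)
Lemma cycle_even c : cycle (adj G) c -> ~~ odd (size c).
Proof.
have [n] := ubnP (size c); elim: n c => // n IHn c cn cy.
have [uc|] := boolP (uniq c); first by apply: bG; rewrite /ucycle cy.
move=> nuc; have [x [r1 [r2 [k rE]]]] : exists x r1 r2 k, rot k c = x :: r1 ++ x :: r2.
  have [x0 c0] : exists x0, x0 \in c by case: (c) nuc => // x0 ? _; exists x0; rewrite mem_head.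
  have /(uniqPn x0)[i [j [ij jc ex]]] := nuc.
  exists (nth x0 c i).
  have : nth x0 c i \in drop i.+1 c ++ take i c.
    by rewrite mem_cat ex -(subnKC ij) -nth_drop mem_nth // size_drop; lia.
  move=> /path.splitPr E; have := erefl (rot i c).
  rewrite {2}/rot (drop_nth x0) /=; last exact: leq_ltn_trans (ltnW ij) jc.
  by case: E => r1 r2 E; exists r1, r2, i.
have := cy; rewrite -(rot_cycle k) rE /= rcons_cat rcons_cons cat_path /= => /and3P[p1 e1 p2].
have c1 : cycle (adj G) (x :: r1) by rewrite /= rcons_path p1.
have c2 : cycle (adj G) (x :: r2) by [].
have sz : size c = (size (x :: r1) + size (x :: r2))%N.
  by rewrite -(size_rot k) rE /= size_cat /= addSn.
rewrite sz oddD (negPf (IHn _ _ c1)) ?(negPf (IHn _ _ c2)) //; first by move: sz => /=; lia.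
by move: sz => /=; lia.
Qed.

Lemma component_trans x y z : component G x y -> component G y z -> component G x z.
Proof.
by move=> [p px <-] [q qy <-]; exists (p ++ q); rewrite ?last_cat // cat_path px.
Qed.

Lemma component_refl x : component G x x.
Proof. by exists [::]. Qed.

Lemma path_adj_rev x p : path (adj G) x p ->
  exists2 q, path (adj G) (last x p) q & last (last x p) q = x /\ size q = size p.
Proof.
move=> px; exists (rev (belast x p)).
  by rewrite rev_path (eq_path (e' := adj G)) // => u v; apply/asboolP/asboolP; exact: Gsym.
by split; [case: p {px} => //= y p; rewrite rev_cons last_rcons|rewrite size_rev size_belast].
Qed.

Lemma component_sym x y : component G x y -> component G y x.
Proof. by move=> [p /path_adj_rev[q qp [qx _]] <-]; exists q. Qed.

Lemma component_edge x y : G (x, y) -> component G x y.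
Proof. by move=> xy; exists [:: y] => //=; rewrite andbT; exact/asboolP. Qed.

(** The side of a vertex is the parity of a path from the root of its component; roots and paths are
    taken by choice, hence without any Borel property. *)
Lemma bipartite_side : exists side : X -> bool, forall x y, G (x, y) -> side x <> side y.
Proof.
have [[x0 _]|X0] := pselect (exists x : X, True); last first.
  by exists (fun=> true) => x; case: X0; exists x.
pose root x := xget x0 (component G x).
have rootP x : component G (root x) x.
  apply: component_sym; rewrite /root; case: xgetP => // /(_ x) []; exact: component_refl.
have rootE x y : G (x, y) -> root x = root y.
  move=> /component_edge xy; congr xget; apply/seteqP; split=> z.
    exact: (component_trans (component_sym xy)).
  exact: component_trans.
have /choice[p pP] x : exists p, path (adj G) (root x) p /\ last (root x) p = x.
  by have [p ? ?] := rootP x; exists p.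
exists (fun x => odd (size (p x))) => x y xy.
have [px lx] := pP x; have [py ly] := pP y.
have [q qy [lq sq]] := path_adj_rev py; rewrite ly in qy lq.
have cw : cycle (adj G) (p x ++ y :: q).
  have : path (adj G) (root x) (p x ++ y :: q).
    by rewrite cat_path px lx /= qy andbT; exact/asboolP.
  have : last (root x) (p x ++ y :: q) = root x by rewrite last_cat /= lq -(rootE _ _ xy).
  case: (p x ++ y :: q) => //= a c ac; rewrite rcons_path ac => /andP[-> ->].
  by [].
move=> e; have /negP := cycle_even cw; apply.
by rewrite size_cat /= addnS sq /= oddD e addbb.
Qed.

End bipartite.

(** * Generic tilings *)

Inductive rtc {X : Type} (R : X -> X -> Prop) (x : X) : X -> Prop :=
| rtc_refl : rtc R x x
| rtc_step y z : rtc R x y -> R y z -> rtc R x z.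

Lemma rtc_trans {X : Type} (R : X -> X -> Prop) x y z : rtc R x y -> rtc R y z -> rtc R x z.
Proof. by move=> xy; elim=> // u v _ xu; exact: rtc_step. Qed.

Lemma rtc_sub {X : Type} (R R' : X -> X -> Prop) x y :
  (forall u v, R u v -> R' u v) -> rtc R x y -> rtc R' x y.
Proof. by move=> RR; elim=> [|u v _ xu /RR]; [exact: rtc_refl|exact: rtc_step]. Qed.

Lemma rtc_sym {X : Type} (R : X -> X -> Prop) x y :
  (forall u v, R u v -> R v u) -> rtc R x y -> rtc R y x.
Proof.
move=> Rsym; elim=> [|u v _ ux /Rsym vu]; first exact: rtc_refl.
by apply: rtc_trans ux; apply: rtc_step vu; exact: rtc_refl.
Qed.

Lemma rtc_component {X : topologicalType} (G : set (X * X)) x y :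
  rtc (fun u v => G (u, v)) x y <-> component G x y.
Proof.
split=> [|[p + <-]].
  elim=> [|u v _ xu uv]; first exact: component_refl.
  exact: component_trans xu (component_edge uv).
elim/last_ind: p => [|p v IHp] /=; first by move=> _; exact: rtc_refl.
rewrite rcons_path last_rcons => /andP[/IHp xu /asboolP uv].
exact: rtc_step xu uv.
Qed.

Lemma cyl_isolate {X : topologicalType} (th : (nat -> nat) -> X) O x (F : seq X) :
  coding th O -> exists s, cyl O s x /\ forall y, y \in F -> cyl O s y -> y = x.
Proof.
move=> cO; have [_ _ _ Oth] := cO; have [//|a [ax _ aO]] := @code_ext _ _ _ cO [::] x.
have [m mP] : exists m, forall y, y \in F -> cyl O (mkseq a m) y -> y = x.
  elim: F => [|z F [m mP]]; first by exists 0%N.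
  have cle k l y : (k <= l)%N -> cyl O (mkseq a l) y -> cyl O (mkseq a k) y.
    move=> kl ly i; rewrite size_mkseq => ik; have := ly i.
    by rewrite size_mkseq !nth_mkseq ?(leq_trans ik) //; apply.
  have [zx|zx] := pselect (z = x).
    by exists m => y; rewrite inE => /orP[/eqP-> //|]; exact: mP.
  have [n nz] : exists n, ~ cyl O (mkseq a n) z.
    apply: contrapT => h; apply: zx; rewrite -ax; apply/esym/Oth => n.
    apply: contrapT => nO; apply: h; exists n.+1 => /(_ n).
    by rewrite size_mkseq nth_mkseq // => /(_ (leqnn _)).
  exists (maxn m n) => y; rewrite inE => /orP[/eqP-> /(cle n) h|yF /(cle m) h].
    by case: nz; apply: h; rewrite leq_maxr.
  by apply: mP yF (h _); rewrite leq_maxl.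
by exists (mkseq a m); split.
Qed.

Section distances.
Context {X : topologicalType} (G : set (X * X)).
Hypothesis Gsym : forall x y, G (x, y) -> G (y, x).

Definition near (k : nat) (x y : X) := exists p, [/\ path (adj G) x p, last x p = y & (size p <= k)%N].

Lemma near_refl k x : near k x x. Proof. by exists [::]. Qed.

Lemma near_sym k x y : near k x y -> near k y x.
Proof.
by move=> [p [/(path_adj_rev Gsym)[q qp [qx <-]] <- pk]]; exists q; split.
Qed.

Lemma near_trans k l x y z : near k x y -> near l y z -> near (k + l) x z.
Proof.
move=> [p [px <- pk]] [q [qy <- ql]]; exists (p ++ q).
by rewrite cat_path px last_cat size_cat leq_add.
Qed.

Lemma near_le k l x y : (k <= l)%N -> near k x y -> near l x y.
Proof. by move=> kl [p [px py pk]]; exists p; split=> //; exact: leq_trans kl. Qed.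

Lemma near_edge x y : G (x, y) -> near 1 x y.
Proof. by move=> xy; exists [:: y]; split=> //=; rewrite andbT; exact/asboolP. Qed.

Definition nbk k (A : set X) : set X := fun x => exists2 y, near k x y & A y.

Lemma nbk_le k l A x : (k <= l)%N -> nbk k A x -> nbk l A x.
Proof. by move=> kl [y /(near_le kl)]; exists y. Qed.

Lemma nbk_near k l A x y : nbk k A x -> near l y x -> nbk (l + k) A y.
Proof. by move=> [z xz Az] yx; exists z => //; exact: near_trans xz. Qed.

Lemma nbk_edge k A x y : nbk k A x -> G (x, y) -> nbk k.+1 A y.
Proof. by move=> kx /near_edge/near_sym/(nbk_near kx). Qed.

Hypothesis Gfin : forall x, exists F : seq X, forall y, G (x, y) -> y \in F.

Lemma near_finite k x : exists F : seq X, forall y, near k x y -> y \in F.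
Proof.
elim: k x => [|k IHk] x.
  by exists [:: x] => y [[|z p] [_ <- //]] _; exact: mem_head.
have [F FP] := Gfin x; have /choice[f fP] := IHk.
exists (x :: flatten (map f F)) => y [[|z p] [/= px <- pk]]; first exact: mem_head.
rewrite inE; apply/orP; right; move: px => /andP[/asboolP xz pz].
apply/flatten_mapP; exists z; first exact: FP.
by apply: fP; exists p.
Qed.

Variable g : nat -> X -> X.
Hypothesis gG : forall x y, G (x, y) -> exists n, g n x = y.

Definition app (w : seq nat) (x : X) : X := foldl (fun z n => g n z) x w.

Fixpoint valid (w : seq nat) (x : X) : Prop :=
  if w is n :: w' then G (x, g n x) /\ valid w' (g n x) else True.

(** Paths become words over the functions [g], so that a quantifier over paths is one over a
    countable set. This is what makes distances and components accessible to Borel formulas. *)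
Lemma near_word k x y : near k x y <-> exists w, [/\ (size w <= k)%N, valid w x & app w x = y].
Proof.
split=> [[p [+ <- +]]|[w [+ + <-]]].
  elim: p x k => [|z p IHp] x k /=; first by exists [::].
  case: k => // k /andP[/asboolP xz /IHp h /h[w [wk vw <-]]].
  by have [n nz] := gG xz; exists (n :: w); rewrite /= nz.
elim: w x k => [|n w IHw] x k /=; first by move=> _ _; exact: near_refl.
case: k => // k wk [xn vw]; rewrite -add1n; apply: near_trans (near_edge xn) _.
exact: IHw.
Qed.

Lemma component_word x y : component G x y <-> exists w, valid w x /\ app w x = y.
Proof.
split=> [[p px <-]|[w [vw <-]]].
  have /near_word[w [_ vw wy]] : near (size p) x (last x p) by exists p.
  by exists w.
by have [p [px py _]] : near (size w) x (app w x) by [apply/near_word; exists w]; exists p.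
Qed.

Context {th : (nat -> nat) -> X} {O : nat -> nat -> set X}.
Hypotheses (cO : coding th O) (bG : borel G) (bg : forall n, borel_fun (g n)).

Lemma borel_app w : borel_fun (app w).
Proof.
elim: w => [|n w IHw]; first exact: borel_fun_id.
exact: borel_fun_comp (bg n) IHw.
Qed.

Lemma borel_valid w : borel (valid w).
Proof.
elim: w => [|n w IHw] /=; first exact: borel_const.
apply: borel_and; first exact: (borel_comp2 cO bG borel_fun_id).
exact: bg IHw.
Qed.

Lemma borel_nbk k A : borel A -> borel (nbk k A).
Proof.
move=> bA; rewrite (_ : nbk k A = fun x => exists w, (size w <= k)%N /\ (valid w x /\ A (app w x))).
  apply: borel_ex => w; apply: borel_and; first exact: borel_const.
  by apply: borel_and; [exact: borel_valid|exact: borel_app bA].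
apply/seteqP; split=> x; first by move=> [_ /near_word[w [wk vw <-]] Aw]; exists w.
by move=> [w [wk [vw Aw]]]; exists (app w x) => //; apply/near_word; exists w.
Qed.

End distances.

(* Each new tile absorbs the earlier tiles close to it, so that the surroundings of
   radius [w] of tiles of different stages are nested or far apart. *)
Section toast.
Context {X : topologicalType} (G : set (X * X)).
Hypothesis Gsym : forall x y, G (x, y) -> G (y, x).
Variable w : nat.

Notation near := (near G).
Notation nbk := (nbk G).

Definition absorb (Q B : set X) : set X := fun x => B x \/ (Q x /\ nbk w.+1 B x).

Definition tile_closure (Z Q : set X) : set X := fun x => exists j, iter j (absorb Q) Z x.

Variable Z : nat -> set X.

Fixpoint decided n : set X :=
  if n is n'.+1 then
    fun x => decided n' x \/ nbk w (tile_closure (Z n') (decided n')) x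
  else set0.

Definition tile n := tile_closure (Z n) (decided n).

(** Chains of jumps model successive absorption: their length has to be bounded, as otherwise a tile
    could grow indefinitely. *)
Definition jump n (u v : X) := [/\ decided n u, decided n v & near w.+1 u v].

(** The step is twice the bound [E = tile_radius n + (w.+1 + jump_radius n)] in the proof of
    [jump_bounded], plus 2. In [tile_radius], the distance [w.+1 + jump_radius n] of a tile point
    from a center is increased by [w] for the surroundings. *)
Fixpoint jump_radius n : nat := if n is n'.+1 then (6 * w + 4 * jump_radius n' + 6)%N else 0%N.

Definition tile_radius n := (2 * w + jump_radius n).+1.

Definition gap n := (4 * tile_radius n + 4 * w + 4)%N.

Hypothesis Zfar : forall n z z', Z n z -> Z n z' -> near (gap n) z z' -> z = z'.

Lemma Z_tile n : Z n `<=` tile n.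
Proof. by move=> x Zx; exists 0%N. Qed.

Lemma tile_absorb n x : decided n x -> nbk w.+1 (tile n) x -> tile n x.
Proof. by move=> dx [y xy [j yj]]; exists j.+1; right; split=> //; exists y. Qed.

Lemma tile_decided m n x : (m < n)%N -> nbk w (tile m) x -> decided n x.
Proof.
elim: n => // n IHn; rewrite ltnS leq_eqVlt => /orP[/eqP->|mn] mx; first by right.
by left; exact: IHn.
Qed.

Lemma jump_sym n u v : jump n u v -> jump n v u.
Proof. by move=> [du dv uv]; split=> //; exact: near_sym. Qed.

(** The absorbed points form a chain of jumps that starts within [w.+1] of a center. The bound on
    such chains is a premise because [jump_bounded] applies this lemma within its own induction. *)
Lemma tile_near n x : (forall u v, rtc (jump n) u v -> near (jump_radius n) u v) ->
  tile n x -> exists2 z, Z n z & near (w.+1 + jump_radius n) z x.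
Proof.
move=> Jn [j]; have : iter j (absorb (decided n)) (Z n) x -> exists2 z, Z n z &
    z = x \/ exists u, [/\ near w.+1 z u, decided n u & decided n x /\ rtc (jump n) u x].
  elim: j x => [|j IHj] x /=; first by exists x => //; left.
  case=> [/IHj //|[dx [y xy /IHj[z Zz [zy|[u [zu du [dy uy]]]]]]]]; exists z => //; right.
    by exists x; split=> //; [rewrite zy; exact: near_sym|split=> //; exact: rtc_refl].
  exists u; split=> //; split=> //; apply: rtc_step uy _; split=> //; exact: near_sym.
move=> h /h[z Zz zx]; exists z => //; case: zx => [->|[u [zu _ [_ /Jn ux]]]]; first exact: near_refl.
exact: near_trans zu ux.
Qed.

(** A chain that is not made of jumps of stage [n] meets the surroundings of a tile of stage [n].
    Its excursions through older points are bounded by induction, so each return to such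
    surroundings is to those of the same center, by [Zfar]. Both ends are therefore close to one
    center. *)
Lemma jump_bounded n u v : rtc (jump n) u v -> near (jump_radius n) u v.
Proof.
elim: n u v => [|n IHn] u v; first by elim=> [|? ? _ _ []//]; exact: near_refl.
have tn x : nbk w (tile n) x -> exists2 z, Z n z & near (tile_radius n) z x.
  move=> [y xy /(tile_near IHn)[z Zz zy]]; exists z => //.
  by apply: near_le (near_trans zy (near_sym Gsym xy)); rewrite /tile_radius; lia.
pose E := (tile_radius n + (w.+1 + jump_radius n))%N.
(* Invariant: the current point is near [z], or it ends a chain of older jumps that began one jump
   away from the ball around [z]. *)
have from_tile z x y : Z n z -> near (tile_radius n) z x -> rtc (jump n.+1) x y -> near E z y.
  move=> Zz zx xy; suff : near (tile_radius n) z y \/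
      exists u, [/\ near (tile_radius n + w.+1) z u, decided n u & decided n y /\ rtc (jump n) u y].
    case=> [|[u' [zu _ [_ /IHn uy]]]]; first by apply: near_le; rewrite /E; lia.
    by apply: near_le (near_trans zu uy); rewrite /E; lia.
  elim: xy => [|y1 y2 _ IH [_ d2 y12]]; first by left.
  case: d2 => [d2|/tn[z' Zz' zy2]].
    right; case: IH => [zy1|[u' [zu du [dy uy]]]].
      exists y2; split=> //; first exact: near_trans zy1 y12.
      by split=> //; exact: rtc_refl.
    by exists u'; split=> //; split=> //; exact: rtc_step uy _.
  left; have zE : near E z y1.
    case: IH => [|[u' [zu _ [_ /IHn uy]]]]; first by apply: near_le; rewrite /E; lia.
    by apply: near_le (near_trans zu uy); rewrite /E; lia.
  rewrite (Zfar Zz Zz') //.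
  apply: near_le (near_trans (near_trans zE y12) (near_sym Gsym zy2)).
  by rewrite /gap /E /tile_radius; lia.
move=> uv; have [|[c [[z Zz zc] cu cv]]] : rtc (jump n) u v \/ exists c,
    [/\ exists2 z, Z n z & near (tile_radius n) z c, rtc (jump n.+1) c u & rtc (jump n.+1) c v].
- elim: uv => [|y1 y2 uy1 IH [d1 d2 y12]]; first by left; exact: rtc_refl.
  case: IH => [uy|[c [cz cu cy]]]; last first.
    by right; exists c; split=> //; exact: rtc_step cy _.
  case: (d2) => [d2'|/tn c2]; last first.
    right; exists y2; split=> //; last exact: rtc_refl.
    apply: rtc_sym; first exact: jump_sym.
    exact: rtc_step uy1 _.
  case: (d1) => [d1'|/tn c1]; first by left; apply: rtc_step uy _.
  right; exists y1; split=> //; first by apply: rtc_sym uy1; exact: jump_sym.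
  by apply: rtc_step (rtc_refl _ _) _.
- by move=> /IHn; apply: near_le => /=; lia.
- have zu := from_tile _ _ _ Zz zc cu; have zv := from_tile _ _ _ Zz zc cv.
  apply: near_le (near_trans (near_sym Gsym zu) zv).
  by rewrite /E /tile_radius /=; lia.
Qed.

Lemma near_tile n x : nbk w (tile n) x -> exists2 z, Z n z & near (tile_radius n) z x.
Proof.
move=> [y xy /(tile_near (@jump_bounded n))[z Zz zy]]; exists z => //.
by apply: near_le (near_trans zy (near_sym Gsym xy)); rewrite /tile_radius; lia.
Qed.

Lemma tile_component n x y : nbk w (tile n) x ->
  rtc (fun u v => G (u, v) /\ nbk w (tile n) v) x y ->
  exists2 z, Z n z & near (tile_radius n) z x /\ near (tile_radius n) z y.
Proof.
move=> /near_tile[z Zz zx] xy; exists z => //; split=> //.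
elim: xy => // u v _ zu [uv /near_tile[z' Zz' zv]].
rewrite (Zfar Zz Zz') //.
apply: near_le (near_trans (near_trans zu (near_edge uv)) (near_sym Gsym zv)).
by rewrite /gap; lia.
Qed.

Hypothesis Gfin : forall x, exists F : seq X, forall y, G (x, y) -> y \in F.

Lemma tile_component_finite n x : nbk w (tile n) x -> exists F : seq X, forall y,
  rtc (fun u v => G (u, v) /\ nbk w (tile n) v) x y -> y \in F.
Proof.
move=> nx; have [F FP] := near_finite Gfin (tile_radius n + tile_radius n) x.
exists F => y /(tile_component nx)[z _ [zx zy]]; apply: FP.
exact: near_trans (near_sym Gsym zx) zy.
Qed.

(** A sphere of thickness two, at distances [5 * i + 3] and [5 * i + 4] from the tile: the edge by
    which a walk crosses from one distance to the other has both ends in it. The period 5 keeps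
    spheres of different index more than 2 apart. *)
Definition on_layer i n : set X :=
  fun x => nbk (5 * i + 4) (tile n) x /\ ~ nbk (5 * i + 2) (tile n) x.

Definition layer i : set X := fun x => exists n, on_layer i n x.

Variable D : nat.
Hypothesis Dw : (5 * D + 10 <= w)%N.

(** If [m < n], then [x] is close to the older tile, hence decided, and close to the tile of stage
    [n], which must have absorbed it. But [x] lies outside that tile. *)
Lemma layer_stage_le i j n m x u : (i < D)%N -> (j < D)%N ->
  on_layer i n x -> on_layer j m u -> near 2 x u -> (n <= m)%N.
Proof.
move=> iD jD [xn nxn] [um _] xu; rewrite leqNgt; apply/negP => mn; apply: nxn.
have /tile_absorb tx : decided n x.
  by apply: tile_decided mn (nbk_le _ (nbk_near um xu)); lia.
by exists x; [exact: near_refl|apply: tx; apply: nbk_le xn; lia].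
Qed.

Lemma layer_stage i j n m x u : (i < D)%N -> (j < D)%N ->
  on_layer i n x -> on_layer j m u -> near 2 x u -> n = m.
Proof.
move=> iD jD xn um xu; apply/eqP; rewrite eqn_leq (layer_stage_le iD jD xn um xu).
exact: layer_stage_le jD iD um xn (near_sym Gsym xu).
Qed.

Lemma layer_far i j x u : (i < j)%N -> (j < D)%N -> layer i x -> layer j u -> ~ near 2 x u.
Proof.
move=> ij jD [n xn] [m um] xu; have iD : (i < D)%N by lia.
have nm := layer_stage iD jD xn um xu; subst m.
case: xn um => xn _ [_]; apply; apply: nbk_le (nbk_near xn (near_sym Gsym xu)); lia.
Qed.

(** By [layer_stage], all points of the layer met along a walk belong to one stage, so that the walk
    stays in the surroundings of the tiles of that stage, whose components are finite. *)
Lemma layer_component_finite i x : (i < D)%N -> exists F : seq X, forall y,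
  rtc (fun u v => G (u, v) /\ (layer i u \/ layer i v)) x y -> y \in F.
Proof.
move=> iD; have [[s xs [n sn]]|ns] := pselect (nbk 1 (layer i) x); last first.
  exists [:: x] => y; elim=> [|u v _ ux [uv uvS]]; first exact: mem_head.
  case: ns; move: ux uv uvS; rewrite inE => /eqP -> xv [xS|vS].
    by exists x => //; exact: near_refl.
  by exists v => //; exact: near_edge.
have wn k y : (k <= 5 * i + 5)%N -> nbk k (tile n) y -> nbk w (tile n) y.
  by move=> ki; apply: nbk_le; lia.
have nx : nbk w (tile n) x.
  by apply: (wn (1 + (5 * i + 4))%N); [lia|exact: nbk_near sn.1 xs].
have [F FP] := tile_component_finite nx; exists F => y xy; apply: FP.
suff [] : rtc (fun u v => G (u, v) /\ nbk w (tile n) v) x y /\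
    exists2 s', near 1 y s' & on_layer i n s' by [].
elim: xy => [|u v _ [xu [s' us' ns']] [uv uvS]]; first by split; [exact: rtc_refl|exists s].
have [t [vt ut tn]] : exists t, [/\ near 1 v t, near 1 u t & layer i t].
  case: uvS => [uS|vS]; [exists u|exists v]; split=> //; try exact: near_refl.
    exact/(near_sym Gsym)/near_edge.
  exact: near_edge.
have {}tn : on_layer i n t.
  have [m tm] := tn.
  by rewrite (layer_stage iD iD ns' tm) //; exact: near_trans (near_sym Gsym us') ut.
split; last by exists t.
apply: rtc_step xu _; split=> //.
by apply: (wn (1 + (5 * i + 4))%N); [lia|exact: nbk_near tn.1 vt].
Qed.

(** A walk from the tile stays within distance [5 * i + 3]: to go farther it would need an edge with
    both ends in the layer, and these are excluded. *)
Lemma off_layer_component_finite i n x : (i < D)%N -> tile n x -> exists F : seq X, forall y,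
  rtc (fun u v => G (u, v) /\ (~ layer i u \/ ~ layer i v)) x y -> y \in F.
Proof.
move=> iD tx; have wx k : nbk k (tile n) x by exists x => //; exact: near_refl.
have [F FP] := tile_component_finite (wx w); exists F => y xy; apply: FP.
suff [] : rtc (fun u v => G (u, v) /\ nbk w (tile n) v) x y /\ nbk (5 * i + 3) (tile n) y by [].
elim: xy => [|u v _ [xu un] [uv nS]]; first by split; [exact: rtc_refl|exact: wx].
have vn : nbk (5 * i + 3) (tile n) v.
  apply: contrapT => nv; have v4 := nbk_edge Gsym un uv.
  case: nS => [nu|nl]; last first.
    apply: nl; exists n; split; first by apply: nbk_le v4; lia.
    by move=> v2; apply: nv; apply: nbk_le v2; lia.
  apply: nu; exists n; split; first by apply: nbk_le un; lia.
  by move=> u2; apply: nv; apply: nbk_le (nbk_edge Gsym u2 uv); lia.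
split=> //; apply: rtc_step xu _; split=> //.
by apply: nbk_le vn; lia.
Qed.

End toast.

(* For every choice of centers some stage works at a given point; a generic sequence of
   choices works at all points of comeagrely many components. *)
Lemma generic_layers (X : topologicalType) (th : (nat -> nat) -> X) O (G : set (X * X)) (g : nat -> X -> X) D :
  coding th O -> borel G -> (forall x y, G (x, y) -> G (y, x)) ->
  (forall x, exists F : seq X, forall y, G (x, y) -> y \in F) ->
  (forall n, borel_fun (g n)) -> (forall x y, G (x, y) -> exists n, g n x = y) ->
  exists (C : set X) (S : nat -> set X),
  [/\ [/\ comeagre C, borel C & forall x y, C x -> component G x y -> C y],
   forall i, borel (S i),
   forall i j x y, (i < j < D)%N -> S i x -> S j y -> ~ near G 2 x y,
   forall i x, (i < D)%N -> exists F : seq X, forall y,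
     rtc (fun u v => G (u, v) /\ (S i u \/ S i v)) x y -> y \in F &
   forall i x, (i < D)%N -> C x -> exists F : seq X, forall y,
     rtc (fun u v => G (u, v) /\ (~ S i u \/ ~ S i v)) x y -> y \in F].
Proof.
move=> cO bG Gsym Gfin bg gG; pose w := (5 * D + 10)%N.
pose U k : set X := cyl O (odflt [::] (unpickle k)).
have bU k : borel (U k) by exact: (borel_open (cyl_open cO _)).
(* Centers for the choice [k]: points that are alone in [U k] up to distance [gap w n]. Separation
   thus holds for every [k], and every point is a center for some [k] because its ball is finite. *)
pose Z n k : set X := fun x => U k x /\ forall v : seq nat,
  ((size v <= gap w n)%N /\ valid G g v x) -> U k (app g v x) -> app g v x = x.
have bZ n k : borel (Z n k).
  apply: borel_and => //; apply: borel_all => v; apply: borel_imp.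
    by apply: borel_and; [exact: borel_const|exact: (borel_valid cO bG bg)].
  apply: borel_imp; first exact: (borel_app bg v (bU k)).
  by apply: (borel_eq cO); [exact: borel_app|exact: borel_fun_id].
have Zcov n x : exists k, Z n k x.
  have [F FP] := near_finite Gfin (gap w n) x.
  have [s [sx sF]] := cyl_isolate x F cO.
  exists (pickle s); split; rewrite /U pickleK //= => v [vn vx]; apply: sF; apply: FP.
  by apply/(near_word gG); exists v.
(* A requirement is a word [r]. Meeting all of them at [x] means that every vertex of the component
   of [x] is a center at some stage, which makes [C] invariant. *)
pose E r n k : set X := fun x => let v := odflt [::] (unpickle r) in
  valid G g v x -> Z n k (app g v x).
have [||p pC] := @generic_choice _ _ _ cO E.
- move=> r n k; apply: borel_imp; first exact: (borel_valid cO bG bg).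
  exact: (borel_app bg _ (bZ n k)).
- by move=> r n x; have [k kP] := Zcov n (app g (odflt [::] (unpickle r)) x); exists k.
pose C : set X := fun x => forall r, exists n, E r n (p n) x.
pose Zp n := Z n (p n).
have CP x : C x <-> forall y, component G x y -> exists n, Zp n y.
  split=> [Cx y /(component_word gG)[v [vx <-]]|h r].
    by have [n] := Cx (pickle v); rewrite /E pickleK /= => /(_ vx); exists n.
  have [vx|nv] := pselect (valid G g (odflt [::] (unpickle r)) x); last by exists 0%N.
  have [|n nP] := h (app g (odflt [::] (unpickle r)) x); last by exists n.
  by apply/(component_word gG); exists (odflt [::] (unpickle r)).
have Zfar n z z' : Zp n z -> Zp n z' -> near G (gap w n) z z' -> z = z'.
  move=> [_ Zz] [Uz' _] /(near_word gG)[v [vn vz vz']].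
  by rewrite -vz'; apply/esym/Zz; rewrite ?vz'.
have btile n : borel (tile G w Zp n) /\ borel (decided G w Zp n).
  have bcl A B : borel A -> borel B -> borel (tile_closure G w A B).
    move=> bA bB; apply: borel_exn => j; elim: j => //= j IHj.
    apply: borel_or => //; apply: borel_and => //.
    exact: (borel_nbk gG cO bG bg).
  have bd : borel (decided G w Zp n).
    elim: n => [|n IHn]; first exact: (borel_open open0).
    by apply: borel_or => //; apply: (borel_nbk gG cO bG bg); apply: bcl => //; exact: bZ.
  by split=> //; apply: bcl => //; exact: bZ.
exists C, (layer G w Zp); split.
- split=> //.
    by apply: borel_all => r; apply: borel_exn => n; apply: borel_imp;
      [exact: (borel_valid cO bG bg)|exact: (borel_app bg _ (bZ n (p n)))].
  move=> x y /CP Cx xy; apply/CP => z yz; apply: Cx; exact: component_trans xy yz.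
- move=> i; apply: borel_exn => n; have [bt _] := btile n.
  by apply: borel_and; [|apply: borel_not]; exact: (borel_nbk gG cO bG bg).
- move=> i j x y /andP[ij jD]; exact: (layer_far Gsym (leqnn _) ij jD).
- by move=> i x iD; apply: (layer_component_finite Gsym Zfar Gfin (leqnn _) _ iD).
- move=> i x iD /CP /(_ x (component_refl _ _))[n /(@Z_tile _ G w Zp) tx].
  exact: (off_layer_component_finite Gsym Zfar Gfin (leqnn _) iD tx).
Qed.

(** * Borel matchings *)

Section borel_matching.
Context {X : topologicalType} {th : (nat -> nat) -> X} {O : nat -> nat -> set X}.
Hypothesis cO : coding th O.
Context {g : nat -> X -> X}.
Hypothesis bg : forall n, borel_fun (g n).

Lemma borel_edges (H : set (X * X)) : (forall x y, H (x, y) -> exists n, g n x = y) ->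
  (forall n, borel (fun x => H (x, g n x))) -> borel H.
Proof.
move=> gH bH; rewrite (_ : H = fun z => exists n, g n z.1 = z.2 /\ H (z.1, g n z.1)).
  apply: borel_exn => n; apply: borel_and; last exact: (borel_fun_fst (bH n)).
  apply: (borel_eq cO); last exact: borel_fun_snd.
  exact: borel_fun_comp borel_fun_fst (bg n).
apply/seteqP; split=> -[x y] /=; last by case=> n [<-].
by move=> Hxy; have [n nxy] := gH _ _ Hxy; exists n; rewrite nxy.
Qed.

Variable H : set (X * X).
Hypotheses (bH : borel H) (Hsym : forall x y, H (x, y) -> H (y, x)).
Hypothesis gH : forall x y, H (x, y) -> exists n, g n x = y.
Hypothesis Hfin : forall x, exists F : seq X, forall y, component H x y -> y \in F.
Context {side : X -> bool}.
Hypothesis Hside : forall x y, H (x, y) -> side x <> side y.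
Variable D : nat.
Hypotheses (D0 : (0 < D)%N).
Hypothesis Hdeg : forall x s, uniq s -> (forall y, y \in s -> H (x, y)) -> (size s <= D)%N.

Notation app := (app g).
Notation valid := (valid H g).

Let full_degree (x : X) := exists t : seq nat, [/\ size t = D, uniq [seq g i x | i <- t] &
  forall i, i \in t -> H (x, g i x)].

Let borel_full_degree : borel full_degree.
Proof.
rewrite (_ : full_degree = fun x => exists t : seq nat, size t = D /\
    (uniq [seq g i x | i <- t] /\ forall i, i \in t -> H (x, g i x))).
  apply: borel_ex => t; apply: borel_and; first exact: borel_const.
  apply: borel_and; last first.
    by apply: borel_all_in => i; apply: (borel_comp2 cO bH) => //; exact: borel_fun_id.
  elim: t => [|i t IHt] /=; first exact: borel_const.
  rewrite (_ : (fun x => _) = fun x => (forall j, j \in t -> ~ g i x = g j x) /\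
      uniq [seq g i0 x | i0 <- t]).
    apply: borel_and => //; apply: borel_all_in => j; apply: borel_not.
    exact: (borel_eq cO).
  apply/seteqP; split=> x /=.
    move=> /andP[/negP it ut]; split=> // j jt ij; apply: it; rewrite ij.
    exact: (map_f (fun k => g k x)).
  move=> [it ->]; rewrite andbT; apply/negP => /mapP[j jt /it]; exact.
by apply/seteqP; split=> x [t]; [move=> [? ? ?]|move=> [? [? ?]]]; exists t; split.
Qed.

(* A component is rooted at its unique point in a suitable basic open set, and a
   finite set of edges is coded by pairs of words read from the root. *)
Let isolated k (x : X) := let U := cyl O (odflt [::] (unpickle k)) in
  U x /\ forall v, valid v x -> U (app v x) -> app v x = x.

Let good (m : seq (seq nat * seq nat)) (y : X) :=
  [/\ forall rt, rt \in m -> valid rt.1 y /\ H (app rt.1 y, app rt.2 y),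
      forall rt, rt \in m -> exists2 rt', rt' \in m & app rt'.1 y = app rt.2 y /\ app rt'.2 y = app rt.1 y,
      forall rt, rt \in m -> forall rt', rt' \in m -> app rt.1 y = app rt'.1 y -> app rt.2 y = app rt'.2 y &
      forall v, valid v y -> full_degree (app v y) -> exists2 rt, rt \in m & app rt.1 y = app v y].

Let bvalid v : borel (valid v).
Proof. exact: (borel_valid cO bH bg). Qed.

Let bapp2 v w : borel (fun x => app v x = app w x).
Proof. by apply: (borel_eq cO); exact: borel_app. Qed.

Let borel_isolated k : borel (isolated k).
Proof.
have bU : borel (cyl O (odflt [::] (unpickle k))) by exact: (borel_open (cyl_open cO _)).
apply: borel_and => //; apply: borel_all => v; apply: borel_imp => //.
apply: borel_imp; first exact: (borel_app bg v bU).
exact: (bapp2 v [::]).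
Qed.

Let borel_good m : borel (good m).
Proof.
rewrite (_ : good m = fun y =>
  (forall rt, rt \in m -> valid rt.1 y /\ H (app rt.1 y, app rt.2 y)) /\
  ((forall rt, rt \in m -> exists2 rt', rt' \in m & app rt'.1 y = app rt.2 y /\ app rt'.2 y = app rt.1 y) /\
  ((forall rt, rt \in m -> forall rt', rt' \in m -> app rt.1 y = app rt'.1 y -> app rt.2 y = app rt'.2 y) /\
   forall v, valid v y -> full_degree (app v y) -> exists2 rt, rt \in m & app rt.1 y = app v y))).
  apply: borel_and.
    apply: borel_all_in => rt; apply: borel_and => //.
    by apply: (borel_comp2 cO bH); exact: borel_app.
  apply: borel_and.
    by apply: borel_all_in => rt; apply: borel_ex_in => rt'; apply: borel_and.
  apply: borel_and.
    by apply: borel_all_in => rt; apply: borel_all_in => rt'; apply: borel_imp.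
  apply: borel_all => v; apply: borel_imp => //; apply: borel_imp.
    exact: (borel_app bg v borel_full_degree).
  by apply: borel_ex_in => rt.
by apply/seteqP; split=> y; [case=> ? ? ? ?; do ![split=> //]|case=> ? [? []]; split].
Qed.

Let rooted (c : nat * seq (seq nat * seq nat)) (v : seq nat) (x : X) :=
  [/\ valid v x, isolated c.1 (app v x) & good c.2 (app v x)].

Let borel_rooted c v : borel (rooted c v).
Proof.
rewrite (_ : rooted c v = fun x => valid v x /\ (isolated c.1 (app v x) /\ good c.2 (app v x))).
  apply: borel_and => //; apply: borel_and.
    exact: (borel_app bg v (borel_isolated c.1)).
  exact: (borel_app bg v (borel_good c.2)).
by apply/seteqP; split=> x; [case|case=> ? []; split].
Qed.

Let comp_app v x : valid v x -> component H x (app v x).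
Proof. by move=> vx; apply/(component_word gH); exists v. Qed.

Let rooted_component c v x y : rooted c v x -> component H x y ->
  exists w, rooted c w y /\ app w y = app v x.
Proof.
move=> [/comp_app vx ix gx] xy.
have /(component_word gH)[w [wy E]] := component_trans (component_sym Hsym xy) vx.
by exists w; split=> //; split=> //; rewrite E.
Qed.

Let rooted_unique c c' v v' x : c.1 = c'.1 -> rooted c v x -> rooted c' v' x -> app v x = app v' x.
Proof.
move=> cc [/comp_app vx [_ ix] _] [/comp_app vx' [U' _] _].
have /(component_word gH)[w [wy E]] := component_trans (component_sym Hsym vx) vx'.
by rewrite -E; apply/esym/ix => //; rewrite E cc.
Qed.

Let rooted_exists x : exists c v, rooted c v x.
Proof.
have [F FP] := Hfin x.
have [s [sx sF]] := cyl_isolate x F cO.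
(* The only place where [side] enters: some finite matching exists. With [x] as the root, [W] names
   the vertices of its component by words. *)
have [M0 [M0H M0fun M0D]] := @seq_matching X (fun u v => H (u, v)) side F D D0 Hsym Hside Hdeg.
have /choice[W WP] a : exists r, component H x a -> valid r x /\ app r x = a.
  have [xa|nxa] := pselect (component H x a); last by exists [::].
  by have /(component_word gH)[r rP] := xa; exists r.
pose m := [seq (W z.1, W z.2) | z <- allpairs pair F F & `[< M0 z.1 z.2 /\ component H x z.1 >]].
have mP a b : M0 a b -> component H x a -> (W a, W b) \in m.
  move=> ab xa; apply/mapP; exists (a, b) => //; rewrite mem_filter; apply/andP; split.
    exact/asboolP.
  by have [_ _ aF bF] := M0H _ _ ab; exact: allpairs_f.
have mI rt : rt \in m -> exists a b, [/\ M0 a b, component H x a, component H x b & rt = (W a, W b)].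
  move=> /mapP[[a b]]; rewrite mem_filter => /andP[/asboolP[ab xa] _] ->; exists a, b; split=> //.
  by have [_ /component_edge Hab _ _] := M0H _ _ ab; exact: component_trans xa Hab.
exists (pickle s, m), [::]; split=> //.
  by split; rewrite pickleK //= => v vx; apply: sF; apply: FP; exact: comp_app.
split.
- move=> _ /mI[a [b [ab xa xb ->]]]; have [va ea] := WP a xa; have [vb eb] := WP b xb.
  by rewrite /= ea eb; split=> //; have [] := M0H _ _ ab.
- move=> _ /mI[a [b [ab xa xb ->]]]; exists (W b, W a) => //.
  by apply: mP xb; have [] := M0H _ _ ab.
- move=> _ /mI[a [b [ab xa xb ->]]] _ /mI[a' [b' [ab' xa' xb' ->]]] /=.
  have [_ ->] := WP a xa; have [_ ->] := WP b xb.
  have [_ ->] := WP a' xa'; have [_ ->] := WP b' xb'.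
  by move=> aa; rewrite -aa in ab'; exact: M0fun ab ab'.
- move=> v /comp_app xv [t [tD tu tH]].
  have [|||y vy] := M0D (app v x) _ _ tu _; last first.
  + by exists (W (app v x), W y); [exact: mP|have [_ ->] := WP _ xv].
  + move=> y /mapP[i it ->]; split; last exact: tH.
    by apply: FP; apply: component_trans xv (component_edge (tH _ it)).
  + by rewrite size_map.
  + exact: FP.
Qed.

Let code n (x : X) := if unpickle n is Some c then exists v, rooted c v x else False.

Let code_component n x y : component H x y -> code n x -> code n y.
Proof.
rewrite /code; case: unpickle => // c xy [v /rooted_component /(_ xy)[w [wy _]]].
by exists w.
Qed.

(** The least code that works is constant on components and a Borel function of the vertex, so that
    all vertices of a component agree on one matching. *)
Let choice_code x := least (code^~ x).

Let choice_codeE x y : component H x y -> choice_code x = choice_code y.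
Proof.
move=> xy; congr least; apply/funext => n; apply/propext; split.
  exact: code_component.
exact/code_component/component_sym.
Qed.

Lemma borel_matching : exists M : set (X * X), [/\ borel M,
  forall x y, M (x, y) -> M (y, x) /\ H (x, y),
  forall x y y', M (x, y) -> M (x, y') -> y = y' &
  forall x s, uniq s -> size s = D -> (forall y, y \in s -> H (x, y)) -> exists y, M (x, y)].
Proof.
pose M : set (X * X) := fun z => H z /\ exists c v, unpickle (choice_code z.1) = Some c /\ (rooted c v z.1 /\
  exists2 rt, rt \in c.2 & app rt.1 (app v z.1) = z.1 /\ app rt.2 (app v z.1) = z.2).
have MH x y : M (x, y) -> H (x, y) by case.
exists M; split.
- apply: borel_edges => [x y /MH /gH //|n].
  apply: borel_and; first exact: (borel_comp2 cO bH borel_fun_id).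
  apply: borel_ex => c; apply: borel_ex => v; apply: borel_and.
    rewrite (_ : (fun x => _) = fun x => exists k, unpickle k = Some c /\ choice_code x = k).
      apply: borel_exn => k; apply: borel_and; first exact: borel_const.
      apply: borel_least => k'; rewrite /code; case: unpickle => [c'|]; last exact: borel_const.
      exact: borel_ex.
    by apply/seteqP; split=> x /=; [exists (choice_code x)|case=> k [kc ->]].
  apply: borel_and => //; apply: borel_ex_in => rt; apply: borel_and.
    apply: (borel_eq cO); last exact: borel_fun_id.
    exact: borel_fun_comp (borel_app bg v) (borel_app bg rt.1).
  apply: (borel_eq cO); last exact: bg.
  exact: borel_fun_comp (borel_app bg v) (borel_app bg rt.2).
- move=> x y Mxy; split; last exact: MH.
  have [Hxy [c [v [cx [rx [rt rtc [/= e1 e2]]]]]]] := Mxy; split; first exact: Hsym.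
  have xy := component_edge Hxy.
  have [w [wy we]] := rooted_component rx xy.
  exists c, w; rewrite /= -(choice_codeE xy); split=> //; split=> //.
  have [_ _ [_ g2 _ _]] := rx; have [rt' rtc' [e1' e2']] := g2 _ rtc.
  by exists rt' => //; rewrite we e1' e2'.
- move=> x y y' [_ [c [v [/= cx [rx [rt rtc [e1 e2]]]]]]] [_ [c' [v' [/= cx' [rx' [rt' rtc' [e1' e2']]]]]]].
  have cc : c = c' by move: cx'; rewrite cx => -[].
  subst c'; have vv := rooted_unique erefl rx rx'.
  rewrite -e2 -e2' -vv; have [_ _ [_ _ g3 _]] := rx; apply: g3 => //.
  by rewrite e1 vv e1'.
- move=> x s us sD sH.
  have fx : full_degree x.
    have /choice[f fP] y : exists n, H (x, y) -> g n x = y.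
      by have [/gH[n nP]|nH] := pselect (H (x, y)); [exists n|exists 0%N].
    have sE : [seq g i x | i <- map f s] = s.
      by rewrite -map_comp -[RHS]map_id; apply/eq_in_map => y /sH /fP.
    exists (map f s); split; rewrite ?size_map ?sE // => i /mapP[y ys ->].
    by rewrite fP; exact: sH.
  have [|cx _] := @leastP (code^~ x).
    by have [c [v r]] := rooted_exists x; exists (pickle c); rewrite /code pickleK; exists v.
  move: cx; rewrite /code; case E: unpickle => [c|//] [v rx].
  have [vx _ [g1 _ _ g4]] := rx.
  have /(component_word gH)[w [wx we]] := component_sym Hsym (comp_app vx).
  have [|rt rtc rtE] := g4 _ wx; first by rewrite we.
  have [_ Hrt] := g1 _ rtc; rewrite rtE we in Hrt.
  exists (app rt.2 (app v x)); split=> //; exists c, v; split=> //; split=> //.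
  by exists rt => //; rewrite rtE.
Qed.

End borel_matching.

(** * Peeling off color classes *)

Section peeling.
Context {X : topologicalType} {th : (nat -> nat) -> X} {O : nat -> nat -> set X}.
Hypothesis cO : coding th O.
Context {g : nat -> X -> X}.
Hypothesis bg : forall n, borel_fun (g n).
Variable G : set (X * X).
Hypotheses (bG : borel G) (Gsym : forall x y, G (x, y) -> G (y, x)).
Hypothesis gG : forall x y, G (x, y) -> exists n, g n x = y.
Context {side : X -> bool}.
Hypothesis Gside : forall x y, G (x, y) -> side x <> side y.
Variable D : nat.
Hypothesis Gdeg : forall x s, uniq s -> (forall y, y \in s -> G (x, y)) -> (size s <= D)%N.
Variable S : nat -> set X.
Hypothesis bS : forall i, borel (S i).
Hypothesis Sfar : forall i j x y, (i < j < D)%N -> S i x -> S j y -> ~ near G 2 x y.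
Hypothesis Son : forall i x, (i < D)%N -> exists F : seq X, forall y,
  rtc (fun u v => G (u, v) /\ (S i u \/ S i v)) x y -> y \in F.
Hypothesis Soff : forall i x, (i < D)%N -> exists F : seq X, forall y,
  rtc (fun u v => G (u, v) /\ (~ S i u \/ ~ S i v)) x y -> y \in F.

Let bS1 i : borel (fun z : X * X => S i z.1).
Proof. exact: borel_fun_fst (bS i). Qed.
Let bS2 i : borel (fun z : X * X => S i z.2).
Proof. exact: borel_fun_snd (bS i). Qed.

Lemma borel_swap (A : set (X * X)) : borel A -> borel (fun z => A (z.2, z.1)).
Proof. by move=> bA; exact: (borel_comp2 cO bA borel_fun_snd borel_fun_fst). Qed.

(* A matching inside the complement of [S i] misses vertices of maximal degree only
   in [S i], where a second matching catches them. *)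
Lemma peel i : (i <= D)%N -> exists (H N : set (X * X)) (M : nat -> set (X * X)),
  [/\ [/\ borel H, forall x y, H (x, y) -> H (y, x), H `<=` G &
       forall x s, uniq s -> (forall y, y \in s -> H (x, y)) -> (size s <= D - i)%N],
      [/\ borel N, forall x y, N (x, y) -> N (y, x) /\ G (x, y),
       forall x y y', N (x, y) -> N (x, y') -> y = y' &
       forall x y, N (x, y) -> exists2 j, (j < i)%N & S j x \/ S j y],
      forall j, [/\ borel (M j), forall x y, M j (x, y) -> M j (y, x) &
       forall x y y', M j (x, y) -> M j (x, y') -> y = y'] &
      forall z, G z -> [\/ H z, N z | exists2 j, (j < i)%N & M j z]].
Proof.
elim: i => [|i IHi] iD.
  exists G, set0, (fun=> set0); split.
  - by split=> // x s; rewrite subn0; exact: Gdeg.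
  - by split=> //; exact: (borel_open open0).
  - by move=> j; split=> //; exact: (borel_open open0).
  - by move=> z Gz; constructor 1.
have [H [N [M [[bH Hsym HG Hdeg] [bN Nsym Nfun NS] MP GHNM]]]] := IHi (ltnW iD).
have d0 : (0 < D - i)%N by rewrite subn_gt0.
pose H1 : set (X * X) := fun z => H z /\ (~ S i z.1 \/ ~ S i z.2).
have [M1 [bM1 M1sym M1fun M1D]] : exists M : set (X * X), [/\ borel M,
    forall x y, M (x, y) -> M (y, x) /\ H1 (x, y),
    forall x y y', M (x, y) -> M (x, y') -> y = y' &
    forall x s, uniq s -> size s = (D - i)%N -> (forall y, y \in s -> H1 (x, y)) -> exists y, M (x, y)].
  apply: (@borel_matching _ _ _ cO _ bg _ _ _ _ _ side) => //.
  - by apply: borel_and => //; apply: borel_or; apply: borel_not.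
  - by move=> x y [/Hsym ? [?|?]]; split=> //; [right|left].
  - by move=> x y [/HG /gG].
  - move=> x; have [F FP] := Soff x iD; exists F => y /rtc_component xy; apply: FP.
    by apply: rtc_sub xy => u v [/HG].
  - by move=> x y [/HG /Gside].
  - by move=> x s us sH; apply: (Hdeg x s us) => y /sH[].
pose H2 : set (X * X) := fun z => (H z /\ ~ M1 z) /\ (S i z.1 \/ S i z.2).
have [N1 [bN1 N1sym N1fun N1D]] : exists M : set (X * X), [/\ borel M,
    forall x y, M (x, y) -> M (y, x) /\ H2 (x, y),
    forall x y y', M (x, y) -> M (x, y') -> y = y' &
    forall x s, uniq s -> size s = (D - i)%N -> (forall y, y \in s -> H2 (x, y)) -> exists y, M (x, y)].
  apply: (@borel_matching _ _ _ cO _ bg _ _ _ _ _ side) => //.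
  - by apply: borel_and; [apply: borel_and => //; exact: borel_not|exact: borel_or].
  - move=> x y [[/Hsym Hyx nM] SS]; split; last by case: SS; [right|left].
    by split=> // /M1sym[].
  - by move=> x y [[/HG /gG]].
  - move=> x; have [F FP] := Son x iD; exists F => y /rtc_component xy; apply: FP.
    by apply: rtc_sub xy => u v [[/HG]].
  - by move=> x y [[/HG /Gside]].
  - by move=> x s us sH; apply: (Hdeg x s us) => y /sH[[]].
exists (fun z => H z /\ ~ (M1 z \/ N1 z)), (fun z => N z \/ N1 z), (fun j => if j == i then M1 else M j).
split.
- split.
  + by apply: borel_and => //; apply: borel_not; exact: borel_or.
  + by move=> x y [/Hsym Hyx nMN]; split=> // -[/M1sym[? _]|/N1sym[? _]]; apply: nMN; [left|right].
  + by move=> z [/HG].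
  + move=> x s us sH; have szs : (size s <= D - i)%N by apply: (Hdeg x s us) => y /sH[].
    rewrite subnS -ltnS prednK // ltn_neqAle szs andbT; apply/eqP => sD.
    (* Suppose that [x] keeps [D - i] neighbors. These are then all its neighbors in [H], and a
       removed matching edge at [x] would lead to one more. *)
    have noextra y : H (x, y) -> y \notin s -> False.
      move=> Hy ys; have : (size (y :: s) <= D - i)%N.
        apply: (Hdeg x); first by rewrite /= ys.
        by move=> u; rewrite inE => /orP[/eqP->//|/sH[]].
      by rewrite /= sD ltnn.
    (* For [x] in [S i] all its remaining edges lie in [H2], otherwise all lie in [H1]. In either
       case there are [D - i] of them, so [N1] or [M1] covers [x]. *)
    have [Sx|nSx] := pselect (S i x).
      have [|y Ny] := N1D x s us sD.
        move=> y /sH[Hy nMN]; split; last by left.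
        by split=> // My; apply: nMN; left.
      have [_ [[Hy _] _]] := N1sym _ _ Ny; apply: (noextra y Hy).
      by apply/negP => /sH[_]; apply; right.
    have [|y My] := M1D x s us sD.
      by move=> y /sH[Hy nMN]; split=> //; left.
    have [_ [Hy _]] := M1sym _ _ My; apply: (noextra y Hy).
    by apply/negP => /sH[_]; apply; left.
- split.
  + exact: borel_or.
  + move=> x y [/Nsym[? ?]|/N1sym[? [[/HG ? _] _]]]; split=> //; [by left|by right].
  (* An edge of [N] meets some earlier [S j] and an edge of [N1] meets [S i]; a common vertex would
     bring these sets within distance 2. *)
  + have mixed x y y' : N (x, y) -> N1 (x, y') -> False.
      move=> Nxy /N1sym[_ [[/HG Gxy' _] SS]].
      have [j ji Sj] := NS _ _ Nxy; have [_ Gxy] := Nsym _ _ Nxy.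
      have n2 : near G 2 y y' by exact: near_trans (near_sym Gsym (near_edge Gxy)) (near_edge Gxy').
      have jiD : (j < i < D)%N by rewrite ji.
      have e1 u v : G (u, v) -> near G 2 u v by move=> /near_edge; exact: near_le.
      case: Sj => Sj; case: SS => Si; apply: (Sfar jiD Sj Si) => //=.
      * exact: near_refl.
      * exact: e1.
      * exact/e1/Gsym.
    move=> x y y' [Nxy|Nxy] [Nxy'|Nxy']; first exact: Nfun Nxy Nxy'.
    * by case: (mixed x y y').
    * by case: (mixed x y' y).
    * exact: N1fun Nxy Nxy'.
  + move=> x y [/NS[j ji Sj]|/N1sym[_ [_ Si]]]; first by exists j => //; exact: ltnW.
    by exists i.
- move=> j; case: eqP => _; last exact: MP.
  by split=> // x y /M1sym[].
- move=> z /GHNM[Hz|Nz|[j ji Mj]].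
  + have [Mz|nM] := pselect (M1 z); first by constructor 3; exists i; rewrite ?eqxx.
    have [Nz|nN] := pselect (N1 z); first by constructor 2; right.
    by constructor 1; split=> // -[].
  + by constructor 2; left.
  + constructor 3; exists j; first exact: ltnW.
    by rewrite (ltn_eqF ji).
Qed.

End peeling.

(** * From matchings to edge colorings and cardinals *)

Lemma color_classes (X Y : topologicalType) (E : set (X * X)) (K : nat -> set (X * X))
    (f : nat -> Y) (P : nat -> Prop) :
  borel E -> (forall k, borel (K k)) -> (forall k x y, K k (x, y) -> K k (y, x)) ->
  (forall k x y y', K k (x, y) -> K k (x, y') -> y = y') ->
  (forall z, E z -> exists k, K k z) -> (forall k z, K k z -> P k) ->
  (forall k l, P k -> P l -> f k = f l -> k = l) ->
  exists c : E -> Y, borel_edge_coloring c.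
Proof.
move=> bE bK Ksym Kfun EK KP finj.
(* The classes may overlap; an edge takes the least one that contains it. [P] marks the indices that
   occur, on which [f] must be injective. *)
exists (fun e : E => f (least (fun k => K k (val e)))); split.
- move=> B _; rewrite (_ : [set val e | e in _] =
      fun z => E z /\ exists k, least (fun k => K k z) = k /\ B (f k)).
    apply: borel_and => //; apply: borel_exn => k; apply: borel_and; last exact: borel_const.
    exact: borel_least.
  apply/seteqP; split=> z /=; last first.
    by move=> [Ez [k [zk Bk]]]; exists (exist _ z (mem_set Ez)) => //=; rewrite zk.
  move=> [e Be <-]; split; first exact: set_valP.
  by exists (least (fun k => K k (val e))).
- move=> e e' ee'; congr (f (least _)); apply/funext => k; apply/propext.
  rewrite ee'; case: (val e) => x y /=; split; exact: Ksym.
- move=> e e' e1 ne ce; apply: ne; apply: val_inj.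
  have [ke _] := leastP (EK _ (set_valP e)).
  have [ke' _] := leastP (EK _ (set_valP e')).
  have kk := finj _ _ (KP _ _ ke) (KP _ _ ke') ce; rewrite -kk in ke'.
  move: e1 ke ke'; case: (val e) => x y; case: (val e') => x' y' /= ->.
  by move=> h h'; rewrite (Kfun _ _ _ _ h h').
Qed.

(** Both chromatic numbers are least elements, so one coloring bounds them. [Y] is first copied into
    [nat -> bool], where cardinals live. *)
Lemma baire_chromatic_le (R : realType) (X Y : topologicalType) (G : set (X * X)) C
    (c : induced G C -> Y) :
  comeagre C -> Defs.invariant G C -> borel C -> polish R Y -> borel_edge_coloring c ->
  baire_edge_chromatic R G #<= [set: Y].
Proof.
move=> cC iC bC pY cc.
have /pcard_injP[f finj] := polish_card_le pY.
have YK : [set: Y] #= f @` setT by apply: card_esym; exact: inj_card_eq.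
pose chi := [set K : cardinal | exists Z : topologicalType,
  [/\ polish R Z, [set: Z] #= K & exists c : induced G C -> Z, borel_edge_coloring c]].
have chiK : chi (f @` setT) by exists Y; split=> //; exists c.
have [|_ /(_ _ chiK) le1] := @least_cardP chi; first by exists (f @` setT).
pose B := [set borel_edge_chromatic R (induced G C0) |
  C0 in [set C0 | [/\ comeagre C0, Defs.invariant G C0 & borel C0]]].
have BC : B (borel_edge_chromatic R (induced G C)) by exists C.
have [|_ /(_ _ BC) le2] := @least_cardP B; first by eexists; exact: BC.
apply: card_le_trans le2 _; apply: card_le_trans le1 _.
by rewrite (card_le_eql (card_esym YK)).
Qed.

Lemma polish_discrete (R : realType) (Y : discreteTopologicalType) :
  countable [set: Y] -> polish R Y.
Proof.
move=> cY; split; first by exists setT => // A A0 _; rewrite setIT.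
pose d (x y : Y) : R := (x != y)%:R.
have d1 x y : d x y < 1 -> x = y by rewrite /d; case: eqP => //= _; rewrite ltxx.
exists d; split.
- split.
  + move=> x y; rewrite /d; split=> [|->]; last by rewrite eqxx.
    by case: eqP => //= _ /eqP; rewrite oner_eq0.
  + by move=> x y; rewrite /d eq_sym.
  + move=> x y z; rewrite /d; case: (eqVneq x y) => [->|_]; first by rewrite add0r.
    by apply: (@le_trans _ _ 1); [rewrite lern1; case: eqP|rewrite lerDl ler0n].
- move=> x A; split.
    by move=> /nbhs_singleton Ax; exists 1 => // y /d1 <-.
  move=> [e e0 eA]; apply: filterS (discrete_set1 x) => y ->.
  by apply: eA; rewrite /= /d eqxx.
- move=> u /(_ 1 ltr01)[N uN]; exists (u N) => A /nbhs_singleton AN.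
  by exists N => // n /= Nn; rewrite -(d1 _ _ (uN _ _ (leqnn N) Nn)).
Qed.

Lemma polish_prod (R : realType) (X : topologicalType) : polish R X -> polish R (X * X)%type.
Proof.
move=> [[A cA dA] [d [[d0 dsym dtri] dN dC]]].
have dxx x : d x x = 0 by apply/d0.
have dge0 x y : 0 <= d x y.
  by have := dtri x y x; rewrite dxx (dsym y) -mulr2n pmulrn_lge0.
have ballN x e : 0 < e -> nbhs x [set y | d x y < e] by move=> e0; apply/dN; exists e.
split.
  exists (A `*` A).
    move/countable_injP: cA => [i iinj]; apply/countable_injP.
    exists (fun z => pickle (i z.1, i z.2)) => -[x y] [x' y'].
    rewrite !inE => -[/= Ax Ay] [/= Ax' Ay'] /(pcan_inj pickleK)[ix iy].
    by congr pair; apply: iinj; rewrite ?inE.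
  move=> U [z Uz] oU; have [[P Q] /= [nP nQ] PQ] : nbhs z U by exact: open_nbhs_nbhs.
  have [||a [Pa Aa]] := dA P°; [by exists z.1|exact: open_interior|].
  have [||b [Qb Ab]] := dA Q°; [by exists z.2|exact: open_interior|].
  exists (a, b); split=> //; apply: PQ; split; exact: interior_subset.
exists (fun z w => d z.1 w.1 + d z.2 w.2); split.
- split.
  + move=> [x y] [x' y'] /=; split=> [|[-> ->]]; last by rewrite !dxx addr0.
    move=> /eqP; rewrite paddr_eq0 // => /andP[/eqP /d0 -> /eqP /d0 ->] //.
  + by move=> z w; rewrite (dsym z.1) (dsym z.2).
  + move=> x y z; have := dtri x.1 y.1 z.1; have := dtri x.2 y.2 z.2; lra.
- move=> [x y] B; split.
    move=> [[P Q] /= [/dN[e e0 eP] /dN[r r0 rQ]] PQ].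
    exists (Num.min e r); first by rewrite lt_min e0.
    move=> [x' y'] /=; rewrite lt_min => /andP[lt1 lt2].
    by apply: PQ; split=> /=; [apply: eP|apply: rQ] => /=; [apply: le_lt_trans lt1|apply: le_lt_trans lt2];
      rewrite ?lerDl ?lerDr.
  move=> [e e0 eB]; have e2 : 0 < e / 2 by rewrite divr_gt0.
  exists ([set x' | d x x' < e / 2], [set y' | d y y' < e / 2]); first by split; exact: ballN.
  by move=> [x' y'] [/= h1 h2]; apply: eB => /=; lra.
- move=> u uC.
  have [|l1 ul1] := dC (fst \o u).
    move=> e /uC[N NP]; exists N => m n Nm Nn; apply: le_lt_trans (NP m n Nm Nn).
    by rewrite /= lerDl.
  have [|l2 ul2] := dC (snd \o u).
    move=> e /uC[N NP]; exists N => m n Nm Nn; apply: le_lt_trans (NP m n Nm Nn).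
    by rewrite /= lerDr.
  exists (l1, l2); have uE : u = fun n => ((fst \o u) n, (snd \o u) n).
    by apply/funext => n /=; case: (u n).
  by rewrite [X in X @ _]uE; exact: cvg_pair ul1 ul2.
Qed.

Section colorings.
Context {X : topologicalType} {th : (nat -> nat) -> X} {O : nat -> nat -> set X}.
Hypotheses (cO : coding th O) (hT : hausdorff X).
Variable G : set (X * X).
Hypotheses (bG : borel G) (Girr : forall x, ~ G (x, x)).
Hypothesis Gsym : forall x y, G (x, y) -> G (y, x).

Lemma comeagre_setT : comeagre [set: X].
Proof. by rewrite /comeagre setCT; exact: meagre0. Qed.

Lemma closed_invariant (C : set X) :
  (forall x y, C x -> component G x y -> C y) -> Defs.invariant G C.
Proof.
move=> CG; exists C; apply/seteqP; split=> x; last by case=> y Cy; exact: CG.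
by move=> Cx; exists x => //; exact: component_refl.
Qed.

Lemma borel_induced (C : set X) : borel C -> borel (induced G C).
Proof.
move=> bC; apply: borel_and => //; apply: borel_and.
  exact: borel_fun_fst bC.
exact: borel_fun_snd bC.
Qed.

Let U k : set X := cyl O (odflt [::] (unpickle k)).

Let bU k : borel (U k).
Proof. exact: (borel_open (cyl_open cO _)). Qed.

(* The lexicographic order for the sequence of basic open sets. *)
Let lt (z : X * X) := exists k, (U k z.1 /\ ~ U k z.2) /\
  forall l : nat, (l < k)%N -> U l z.1 <-> U l z.2.

Let borel_lt : borel lt.
Proof.
have bU1 k : borel (fun z : X * X => U k z.1) by exact: borel_fun_fst (bU k).
have bU2 k : borel (fun z : X * X => U k z.2) by exact: borel_fun_snd (bU k).
apply: borel_exn => k; apply: borel_and.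
  by apply: borel_and => //; exact: borel_not.
apply: borel_all => l; apply: borel_imp; first exact: borel_const.
by apply: borel_and; exact: borel_imp.
Qed.

Let lt_total x y : x <> y -> lt (x, y) \/ lt (y, x).
Proof.
move=> xy; pose P k := ~ (U k x <-> U k y).
have [|Pk kmin] := @leastP P.
  have [s sx nsy] := cyl_sep cO xy; exists (pickle s); rewrite /P /U pickleK /=.
  by move=> [/(_ sx)].
have below l : (l < least P)%N -> U l x <-> U l y.
  by move=> lk; apply: contrapT => /kmin; rewrite leqNgt lk.
have [Ux|nUx] := pselect (U (least P) x).
  left; exists (least P); split=> //; split=> // Uy; exact: Pk.
right; exists (least P); split=> [|l /below[? ?]]; last by split.
by split=> //=; apply: contrapT => nUy; apply: Pk; split.
Qed.

Let lt_asym x y : lt (x, y) -> lt (y, x) -> False.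
Proof.
move=> [k [[/= kx nky] kl]] [l [[/= ly nlx] lk]].
have [kltl|lltk|e] := ltngtP k l.
- by apply: nky; apply/(lk _ kltl).
- by apply: nlx; apply/(kl _ lltk).
- by subst l.
Qed.

(** Listing the endpoints in the order [lt] turns an unordered pair into a point of [X * X] in a
    Borel way, so that the color space is Polish. *)
Lemma unordered_pair_coloring : exists c : induced G setT -> (X * X)%type, borel_edge_coloring c.
Proof.
have GT : induced G setT = G by apply/seteqP; split=> z; [case|split].
pose o (z : X * X) : X * X := if pselect (lt z) then z else (z.2, z.1).
exists (fun e : induced G setT => o (val e)); split.
- move=> B bB; rewrite (_ : [set val e | e in _] =
      fun z => G z /\ ((lt z /\ B z) \/ (~ lt z /\ B (z.2, z.1)))).
    apply: borel_and => //; apply: borel_or; apply: borel_and => //; first exact: borel_not.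
    exact: (borel_swap cO bB).
  apply/seteqP; split=> z /=.
    move=> [e + <-]; rewrite /o; have Ge : G (val e) by have := set_valP e; case.
    by case: pselect => l Be; split=> //; [left|right].
  move=> [Gz Bz]; have Gz' : induced G setT z by rewrite GT.
  exists (exist _ z (mem_set Gz')) => //=; rewrite /o.
  by case: pselect => l; case: Bz => -[].
- move=> e f; case: (val e) (set_valP e) => x y /= [Gxy _] ->; rewrite /o /=.
  have xy : x <> y by move=> xy; rewrite xy in Gxy; exact: Girr Gxy.
  case: pselect => l; case: pselect => l' //=; first by case: (lt_asym l l').
  by case: (lt_total xy).
- move=> e f; case eE: (val e) => [x y]; case fE: (val f) => [x' y'] /= xx ne; subst x'.
  have yy : y <> y'.
    by move=> yy; apply: ne; apply: val_inj; rewrite eE fE yy.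
  by rewrite /o /=; case: pselect => l; case: pselect => l' //= -[] *; apply: yy; congruence.
Qed.

Context {g : nat -> X -> X}.
Hypothesis bg : forall n, borel_fun (g n).
Hypothesis gG : forall x y, G (x, y) -> exists n, g n x = y.

Lemma countable_coloring : exists c : induced G setT -> nat, borel_edge_coloring c.
Proof.
have GT : induced G setT = G by apply/seteqP; split=> z; [case|split].
(* In the class [a], a vertex of the first cylinder has its partner given by [g a.1.1], a vertex of
   the second one by [g a.1.2]. As the cylinders are disjoint, no vertex has partners of both
   kinds. *)
pose E (a : (nat * nat) * (seq nat * seq nat)) (z : X * X) :=
  (cyl O a.2.1 `&` cyl O a.2.2 = set0) /\ ((g a.1.1 z.1 = z.2 /\ g a.1.2 z.2 = z.1) /\
  (cyl O a.2.1 z.1 /\ cyl O a.2.2 z.2)).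
have bE a : borel (E a).
  apply: borel_and; first exact: borel_const.
  apply: borel_and; apply: borel_and.
  - apply: (borel_eq cO); last exact: borel_fun_snd.
    exact: borel_fun_comp borel_fun_fst (bg _).
  - apply: (borel_eq cO); last exact: borel_fun_fst.
    exact: borel_fun_comp borel_fun_snd (bg _).
  - exact: borel_fun_fst (borel_open (cyl_open cO _)).
  - exact: borel_fun_snd (borel_open (cyl_open cO _)).
pose K k (z : X * X) := if unpickle k is Some a then E a z \/ E a (z.2, z.1) else False.
apply: (@color_classes X nat _ K id (fun=> True)) => //.
- by rewrite GT.
- move=> k; rewrite /K; case: unpickle => [a|]; last exact: borel_const.
  by apply: borel_or => //; exact: (borel_swap cO).
- by move=> k x y; rewrite /K; case: unpickle => // a [?|?]; [right|left].
- move=> k x y y'; rewrite /K; case: unpickle => // a.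
  have dis u : cyl O a.2.1 `&` cyl O a.2.2 = set0 -> cyl O a.2.1 u -> cyl O a.2.2 u -> False.
    by move=> d0 u1 u2; rewrite -[False]/(set0 u) -d0.
  move=> [] [d0 [[/= e1 e2] [s1 s2]]] [] [_ [[/= f1 f2] [t1 t2]]].
  + by rewrite -e1 -f1.
  + by case: (dis x).
  + by case: (dis x).
  + by rewrite -e2 -f2.
- move=> [x y]; rewrite GT => Gxy.
  have /hT[P [Q [/(open_cyl cO)[s sx sP] /(open_cyl cO)[t ty tQ] PQ]]] : x <> y.
    by move=> xy; rewrite xy in Gxy; exact: Girr Gxy.
  have [i ixy] := gG Gxy; have [j jyx] := gG (Gsym Gxy).
  exists (pickle ((i, j), (s, t))); rewrite /K pickleK; left; split=> //=.
  by apply/seteqP; split=> // z [/sP Pz /tQ Qz]; exact: PQ Pz Qz.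
Qed.

Lemma finite_coloring n : bipartite G ->
  (forall x, exists F : seq X, forall y, G (x, y) -> y \in F) ->
  (forall x s, uniq s -> (forall y, y \in s -> G (x, y)) -> (size s <= n)%N) ->
  exists C, [/\ comeagre C, Defs.invariant G C, borel C &
    exists c : induced G C -> discrete_topology 'I_n.+1, borel_edge_coloring c].
Proof.
move=> bipG Gfin Gdeg; have [side sideP] := bipartite_side Gsym bipG.
have [C [S [[cC bC CG] bS Sfar Son Soff]]] := generic_layers n cO bG Gsym Gfin bg gG.
exists C; split=> //; first exact: closed_invariant.
have subG : induced G C `<=` G by move=> z [].
have subrtc (Q : X -> X -> Prop) x y : rtc (fun u v => induced G C (u, v) /\ Q u v) x y ->
    rtc (fun u v => G (u, v) /\ Q u v) x y.
  by apply: rtc_sub => u v [[]].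
have [||||||||H [N [M [[_ _ HG Hdeg] [bN Nsym Nfun _] MP GHNM]]]] :=
  @peel X th O cO g bg (induced G C) _ _ _ side _ n _ S bS _ _ _ n (leqnn n).
- exact: borel_induced.
- by move=> x y [/Gsym Gyx [/= Cx Cy]]; split.
- by move=> x y [/gG].
- by move=> x y [/sideP].
- by move=> x s us sG; apply: (Gdeg x s us) => y /sG[].
- move=> i j x y ij Si Sj [p [px py pn]]; apply: (Sfar i j x y ij Si Sj); exists p; split=> //.
  by apply: sub_path px => u v /asboolP[Guv _]; exact/asboolP.
- by move=> i x iD; have [F FP] := Son i x iD; exists F => y /subrtc /FP.
(* A vertex outside [C] has no edge in [induced G C], so nothing else is reached from it. *)
- move=> i x iD; have [Cx|nCx] := pselect (C x).
    by have [F FP] := Soff i x iD Cx; exists F => y /subrtc /FP.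
  exists [:: x] => y; elim=> [|u v _ + [[_ [/= Cu _]] _]]; first exact: mem_head.
  by rewrite inE => /eqP ux; rewrite ux in Cu.
have H0 z : ~ H z.
  case: z => x y Hxy; suff : (size [:: y] <= n - n)%N by rewrite subnn.
  by apply: (Hdeg x) => // u; rewrite inE => /eqP ->.
pose K k := if (k < n)%N then M k else if k == n then N else set0.
have bK0 : borel (@set0 (X * X)) by exact: (borel_open open0).
apply: (@color_classes X (discrete_topology 'I_n.+1) _ K (fun k => (inord k : 'I_n.+1)) (fun k => (k <= n)%N)).
- exact: borel_induced.
- by move=> k; rewrite /K; case: ifP => _; [have [] := MP k|case: ifP].
- move=> k x y; rewrite /K; case: ifP => _; first by have [_ + _] := MP k; apply.
  by case: ifP => // _ /Nsym[].
- move=> k x y y'; rewrite /K; case: ifP => _; first by have [_ _ +] := MP k; apply.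
  by case: ifP => // _; exact: Nfun.
- move=> z /GHNM[/H0 //|Nz|[j jn Mj]].
    by exists n; rewrite /K ltnn eqxx.
  by exists j; rewrite /K jn.
- by move=> k z; rewrite /K; case: ltngtP => // ->.
- by move=> k l kn ln /(congr1 (@nat_of_ord _)); rewrite !inordK.
Qed.

End colorings.

Lemma card_neighbors (X : topologicalType) (G : set (X * X)) x n (s : seq X) :
  neighbors G x #<= `I_n -> uniq s -> (forall y, y \in s -> G (x, y)) -> (size s <= n)%N.
Proof.
move=> Gn us sG; case: s us sG => // y0 s us sG; set s' := y0 :: s in us sG *.
rewrite -card_le_II; apply: card_le_trans Gn.
have inj : {in `I_(size s') &, injective (nth y0 s')}.
  move=> i j; rewrite !inE => il jl e; apply/eqP.
  by rewrite -(nth_uniq y0 il jl us) e.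
rewrite (card_le_eql (card_esym (inj_card_eq inj))).
by apply: subset_card_le => _ [i il <-]; apply: sG; exact: mem_nth.
Qed.

Lemma card_succ_II (D : cardinal) n : D #= `I_n -> card_succ D #= `I_n.+1.
Proof.
move=> Dn; apply/eq_cardSP; exists None; first by left.
rewrite (_ : _ `\ None = Some @` D); first exact: card_eq_trans card_some Dn.
apply/seteqP; split=> [z [[zN|//] nzN]|_ [b Db <-]]; first by case: nzN.
by split=> //; right; exists b.
Qed.

Lemma card_le_succ (D : cardinal) : D #<= card_succ D.
Proof.
rewrite -(card_le_eql card_some); apply: subset_card_le => z Dz; by right.
Qed.

Theorem theorem1p1 (R : realType) (X : topologicalType) (G : set (X * X)) :
  polish R X -> borel_graph G -> bipartite G ->
  baire_edge_chromatic R G #<= card_succ (max_degree G).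
Proof.
move=> pX [bG Girr Gsym] bipG; have [maxdeg _] := max_degreeP G pX.
have invT : Defs.invariant G setT by exact: closed_invariant.
have bT : borel [set: X] by exact: (borel_open openT).
(* A chart needs a point. For empty [X] there are no edges, and [X] itself serves as the empty color
   space. *)
have [[x0 _]|X0] := pselect (exists x : X, True); last first.
  have abs (e : induced G setT) : False by apply: X0; exists (val e).1.
  have cc : borel_edge_coloring (fun e : induced G setT => (val e).1).
    split=> [B bB|e|e]; [|by case: (abs e)|by case: (abs e)].
    rewrite (_ : [set val e | e in _] = set0); first exact: (borel_open open0).
    by apply/seteqP; split=> // z [e]; case: (abs e).
  apply: card_le_trans (baire_chromatic_le comeagre_setT invT bT pX cc) _.
  rewrite (_ : [set: X] = set0) ?card_ge0 //.
  by apply/seteqP; split=> // x _; apply: X0; exists x.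
have [hT [th [O cO]]] := polish_chart x0 pX.
have [[g [bg gG]]|[x [h [hinj hG]]]] := lusin_novikov cO hT bG; last first.
  (* The injection [h] makes [max_degree G] at least the continuum, which bounds the size of every
     Polish space, in particular that of [X * X]. *)
  have [c cc] := unordered_pair_coloring cO bG Girr.
  apply: card_le_trans (baire_chromatic_le comeagre_setT invT bT (polish_prod pX) cc) _.
  apply: card_le_trans (card_le_succ _); apply: card_le_trans (maxdeg x).
  apply: card_le_trans (polish_card_le (polish_prod pX)) _.
  rewrite (card_le_eql (card_esym (inj_card_eq (f := h) (in2W hinj)))).
  by apply: subset_card_le => _ [b _ <-]; exact: hG.
have [Dfin|Dinf] := pselect (finite_set (max_degree G)); last first.
  have [c cc] := countable_coloring cO hT bG Girr Gsym bg gG.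
  apply: card_le_trans (baire_chromatic_le comeagre_setT invT bT (polish_discrete R _) cc) _.
    exact: card_lexx.
  by apply: card_le_trans (card_le_succ _); exact/infiniteP.
have [n Dn] : exists n, max_degree G #= `I_n by exact/finite_setP.
have degn x : neighbors G x #<= `I_n by apply: card_le_trans (maxdeg x) _; rewrite (card_le_eql Dn).
have [||C [cC iC bC [c cc]]] := @finite_coloring X th O cO G bG Gsym g bg gG n bipG.
- move=> x; have /finite_seqP[F FE] : finite_set (neighbors G x).
    exact: card_le_finite (degn x) (finite_II n).
  exists F => y Gxy; have : neighbors G x y by [].
  by rewrite FE.
- by move=> x s; exact: card_neighbors.
apply: card_le_trans (baire_chromatic_le cC iC bC (polish_discrete R _) cc) _.
  exact: (@countableP 'I_n.+1 setT).
rewrite (card_le_eqr (card_succ_II Dn)).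
by have /card_eqPle[] := @card_II n.+1.
Qed.
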